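(* Let $k$ be a field and let $\mathcal{H}=(H,\cdot,\mathbin{:})$ be a $q$-magma coalgebra, where $H$ is a Hopf algebra over $k$. Put $h\times l:=(l\cdot h_{(1)})h_{(2)}$ and $h\boxtimes l:=(l\mathbin{:}h_{(2)})h_{(1)}$ for $h,l\in H$. Consider, for all $h,m,l\in H$, the equalities (a1) $h\cdot ml=(h\cdot l)\cdot m$, (a2) $(m\boxtimes l)\cdot h=(m\cdot h_{(2)})\boxtimes(l\cdot h_{(1)})$, (a3) $h\cdot(m\times l)=h\cdot(l\boxtimes m)$, (b1) $h\mathbin{:}ml=(h\mathbin{:}l)\mathbin{:}m$, (b2) $(m\times l)\mathbin{:}h=(m\mathbin{:}h_{(1)})\times(l\mathbin{:}h_{(2)})$, (b3) $h\mathbin{:}(m\times l)=h\mathbin{:}(l\boxtimes m)$. If $\mathcal{H}$ is a Hopf $q$-brace, then $\times$ and $\boxtimes$ are associative with unit $1$, and the equalities (a1), (a2), (a3), (b1), (b2), (b3) hold for all $h,m,l\in H$. Conversely, if $\times$ and $\boxtimes$ are associative with left unit $1$, and (a1), (a3), (b1), (b2) and (b3) are satisfied for all $h,m,l\in H$, then $\mathcal{H}$ is a Hopf $q$-brace.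
   Context: All vector spaces, maps and tensor products are over $k$ (maps are linear); Sweedler notation is used; $\epsilon$ is the counit; $H^{\mathrm{cop}}$, $H^{\mathrm{op}}$ denote opposite coalgebra/algebra. Multiplication in $H$ binds tighter than $\cdot$, $\mathbin{:}$, $\times$, $\boxtimes$. A triple $(H,\cdot,\mathbin{:})$ with linear maps $\cdot,\mathbin{:}\colon H\otimes H\to H$ satisfying $\epsilon(x\cdot y)=\epsilon(x\mathbin{:}y)=\epsilon(x)\epsilon(y)$ is a $q$-magma coalgebra if $H\otimes H^{\mathrm{cop}}\to H^{\mathrm{cop}}\otimes H$, $x\otimes y\mapsto y_{(1)}\mathbin{:}x_{(2)}\otimes x_{(1)}\cdot y_{(2)}$, is a coalgebra morphism; left regular if $x\otimes y\mapsto x\cdot y_{(1)}\otimes y_{(2)}$ is invertible; a $q$-cycle coalgebra if it is left regular and for all $x,y,z$: $(x\cdot y_{(1)})\cdot(z\mathbin{:}y_{(2)})=(x\cdot z_{(2)})\cdot(y\cdot z_{(1)})$, $(x\cdot y_{(1)})\mathbin{:}(z\cdot y_{(2)})=(x\mathbin{:}z_{(2)})\cdot(y\mathbin{:}z_{(1)})$, $(x\mathbin{:}y_{(1)})\mathbin{:}(z\mathbin{:}y_{(2)})=(x\mathbin{:}z_{(2)})\mathbin{:}(y\cdot z_{(1)})$. It is a Hopf $q$-brace if it is a $q$-cycle coalgebra, $H$ is a right $H^{\mathrm{op}}$-module via $\cdot$ and via $\mathbin{:}$ (that is, $h\cdot1=h$, $h\cdot ml=(h\cdot l)\cdot m$ and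 likewise for $\mathbin{:}$), and $hm\cdot l=(h\cdot(l_{(1)}\mathbin{:}m_{(2)}))(m_{(1)}\cdot l_{(2)})$ and $hm\mathbin{:}l=(h\mathbin{:}(l_{(1)}\cdot m_{(2)}))(m_{(1)}\mathbin{:}l_{(2)})$ for all $h,m,l\in H$. *)

(* Defs.v *)
From HB Require Import structures.
From mathcomp Require Import all_boot all_order all_algebra.
From mathcomp Require Import boolp.

Set Implicit Arguments.
Unset Strict Implicit.
Unset Printing Implicit Defensive.

Import GRing.Theory.
Local Open Scope ring_scope.
Local Open Scope quotient_scope.

Definition bilin (k : fieldType) (U V W : lmodType k) (f : U -> V -> W) : Prop :=
  (forall v, linear (f^~ v)) /\ (forall u, linear (f u)).

(* The tensor product U (x) V: formal sums of pairs (u, v), represented by     *)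
(* sequences, modulo the congruence generated by bilinearity.                 *)
Inductive tensor_rel (k : fieldType) (U V : lmodType k) :
    seq (U * V) -> seq (U * V) -> Prop :=
| TRefl s : tensor_rel s s
| TSym s t : tensor_rel s t -> tensor_rel t s
| TTrans s t r : tensor_rel s t -> tensor_rel t r -> tensor_rel s r
| TCat s s' t t' :
    tensor_rel s s' -> tensor_rel t t' -> tensor_rel (s ++ t) (s' ++ t')
| TComm s t : tensor_rel (s ++ t) (t ++ s)
| TAddl u u' v : tensor_rel [:: (u + u', v)] [:: (u, v); (u', v)]
| TAddr u v v' : tensor_rel [:: (u, v + v')] [:: (u, v); (u, v')]
| TScale a u v : tensor_rel [:: (a *: u, v)] [:: (u, a *: v)]
| TZero v : tensor_rel [:: (0, v)] [::].

Section Tensor.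
Variables (k : fieldType) (U V : lmodType k).
Implicit Types (s t : seq (U * V)).

Definition tensor_relb : rel (seq (U * V)) := fun s t => `[< tensor_rel s t >].

Fact tensor_relb_refl : reflexive tensor_relb.
Proof. by move=> s; apply/asboolP; apply: TRefl. Qed.
Fact tensor_relb_sym : symmetric tensor_relb.
Proof. by move=> s t; apply: asbool_equiv_eq; split; apply: TSym. Qed.
Fact tensor_relb_trans : transitive tensor_relb.
Proof.
by move=> s t r /asboolP st /asboolP sr; apply/asboolP; apply: TTrans st sr.
Qed.

Canonical tensor_equiv :=
  EquivRel tensor_relb tensor_relb_refl tensor_relb_sym tensor_relb_trans.

Definition tensor := {eq_quot tensor_relb}.
HB.instance Definition _ := Choice.on tensor.
HB.instance Definition _ := EqQuotient.on tensor.

Lemma tensor_eqP s t : (\pi_tensor s = \pi_tensor t) <-> tensor_rel s t.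
Proof. by split=> [/eqquotP/asboolP//|st]; apply/eqquotP/asboolP. Qed.

Lemma tensor_reprK s : tensor_rel (repr (\pi_tensor s)) s.
Proof. by apply/tensor_eqP; rewrite reprK. Qed.

Lemma tensor_surj (x : tensor) : exists s, x = \pi_tensor s.
Proof. by exists (repr x); rewrite reprK. Qed.

Definition tens (u : U) (v : V) : tensor := \pi_tensor [:: (u, v)].

Definition tensor_add (x y : tensor) : tensor := \pi_tensor (repr x ++ repr y).
Definition tensor_zero : tensor := \pi_tensor [::].
Definition tensor_scale (a : k) (x : tensor) : tensor :=
  \pi_tensor [seq (a *: p.1, p.2) | p <- repr x].

Lemma tensor_addE s t :
  tensor_add (\pi_tensor s) (\pi_tensor t) = \pi_tensor (s ++ t).
Proof. by apply/tensor_eqP; apply: TCat; apply: tensor_reprK. Qed.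

Lemma tensor_rel_scale a s t : tensor_rel s t ->
  tensor_rel [seq (a *: p.1, p.2) | p <- s] [seq (a *: p.1, p.2) | p <- t].
Proof.
elim=> {s t} /=.
- by move=> s; apply: TRefl.
- by move=> s t _; apply: TSym.
- by move=> s t r _ + _; apply: TTrans.
- by move=> s s' t t' _ ? _ ?; rewrite !map_cat; apply: TCat.
- by move=> s t; rewrite !map_cat; apply: TComm.
- by move=> u u' v; rewrite scalerDr; apply: TAddl.
- by move=> u v v'; apply: TAddr.
- by move=> b u v; rewrite scalerA mulrC -scalerA; apply: TScale.
- by move=> v; rewrite scaler0; apply: TZero.
Qed.

Lemma tensor_scaleE a s :
  tensor_scale a (\pi_tensor s) = \pi_tensor [seq (a *: p.1, p.2) | p <- s].
Proof. by apply/tensor_eqP/tensor_rel_scale/tensor_reprK. Qed.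


Fact tensor_addA : associative tensor_add.
Proof.
move=> x y z; have [s ->] := tensor_surj x; have [t ->] := tensor_surj y; have [r ->] := tensor_surj z.
by rewrite !tensor_addE catA.
Qed.
Fact tensor_addC : commutative tensor_add.
Proof.
move=> x y; have [s ->] := tensor_surj x; have [t ->] := tensor_surj y.
by rewrite !tensor_addE; apply/tensor_eqP/TComm.
Qed.
Fact tensor_add0 : left_id tensor_zero tensor_add.
Proof. by move=> x; have [s ->] := tensor_surj x; rewrite tensor_addE. Qed.

HB.instance Definition _ :=
  GRing.isNmodule.Build tensor tensor_addA tensor_addC tensor_add0.

Lemma tensor_pi_cat s t : \pi_tensor (s ++ t) = \pi_tensor s + \pi_tensor t.
Proof. by rewrite -tensor_addE. Qed.

Lemma tensor_piE s : \pi_tensor s = \sum_(p <- s) tens p.1 p.2.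
Proof.
elim: s => [|[u v] s IH]; first by rewrite big_nil.
by rewrite big_cons -IH -cat1s tensor_pi_cat.
Qed.

Lemma tensDl u u' v : tens (u + u') v = tens u v + tens u' v.
Proof. by rewrite /tens -tensor_pi_cat; apply/tensor_eqP/TAddl. Qed.
Lemma tensDr u v v' : tens u (v + v') = tens u v + tens u v'.
Proof. by rewrite /tens -tensor_pi_cat; apply/tensor_eqP/TAddr. Qed.
Lemma tens0l v : tens 0 v = 0.
Proof. by apply/tensor_eqP/TZero. Qed.

Lemma tensor_sumE (x : tensor) : x = \sum_(p <- repr x) tens p.1 p.2.
Proof. by rewrite -tensor_piE reprK. Qed.

Lemma tensor_scale_sum a s :
  tensor_scale a (\sum_(p <- s) tens p.1 p.2) =
  \sum_(p <- s) tens (a *: p.1) p.2.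
Proof. by rewrite -tensor_piE tensor_scaleE tensor_piE big_map. Qed.

Fact tensor_scaleA a b x : tensor_scale a (tensor_scale b x) = tensor_scale (a * b) x.
Proof.
have [s ->] := tensor_surj x; rewrite !tensor_scaleE -map_comp.
by congr \pi_tensor; apply: eq_map => p /=; rewrite scalerA.
Qed.
Fact tensor_scale1 : left_id 1 tensor_scale.
Proof.
move=> x; have [s ->] := tensor_surj x; rewrite tensor_scaleE; congr \pi_tensor.
by rewrite -[RHS]map_id; apply: eq_map => -[u v] /=; rewrite scale1r.
Qed.
Fact tensor_scaleDr : right_distributive tensor_scale +%R.
Proof.
move=> a x y; have [s ->] := tensor_surj x; have [t ->] := tensor_surj y.
by rewrite -tensor_pi_cat !tensor_scaleE map_cat tensor_pi_cat.
Qed.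
Fact tensor_scaleDl x : {morph tensor_scale^~ x : a b / a + b}.
Proof.
move=> a b; rewrite [x]tensor_sumE !tensor_scale_sum -big_split /=.
by apply: eq_bigr => p _; rewrite scalerDl tensDl.
Qed.
Fact tensor_addN : left_inverse 0 (tensor_scale (-1)) +%R.
Proof.
move=> x; rewrite -{2}[x]tensor_scale1 -tensor_scaleDl addNr.
rewrite [x]tensor_sumE tensor_scale_sum big1 // => p _.
by rewrite scale0r tens0l.
Qed.

HB.instance Definition _ := GRing.Nmodule_isZmodule.Build tensor tensor_addN.
HB.instance Definition _ := GRing.Zmodule_isLmodule.Build k tensor
  tensor_scaleA tensor_scale1 tensor_scaleDr tensor_scaleDl.

Lemma tensZl a u v : tens (a *: u) v = a *: tens u v.
Proof. by rewrite [RHS]tensor_scaleE. Qed.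
Lemma tensZr a u v : tens u (a *: v) = a *: tens u v.
Proof. by rewrite -tensZl; apply/esym/tensor_eqP/TScale. Qed.

Fact tens_bilin : bilin tens.
Proof.
split=> [v a u u'|u a v v'] /=; first by rewrite tensDl tensZl.
by rewrite tensDr tensZr.
Qed.
HB.instance Definition _ := bilinear_isBilinear.Build k U V tensor
  *:%R *:%R tens (tens_bilin.1, tens_bilin.2).

End Tensor.

Notation "U \ot V" := (tensor U V) (at level 40, left associativity) : type_scope.
Notation "u \ox v" := (tens u v) (at level 40, left associativity) : ring_scope.

(* tensor_lift f is the linear map u \ox v |-> f u v when f is bilinear (see   *)
(* tensor_liftE, tensor_lift_linear); for other f it depends on repr.         *)
Definition tensor_lift (k : fieldType) (U V W : lmodType k) (f : U -> V -> W)
    (x : U \ot V) : W :=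
  \sum_(p <- repr x) f p.1 p.2.

Lemma lin0 (k : fieldType) (U W : lmodType k) (F : U -> W) : linear F -> F 0 = 0.
Proof. by move=> lF; have := lF (-1) 0 0; rewrite !scaler0 !addr0 scaleN1r addNr. Qed.

Section TensorLift.
Variables (k : fieldType) (U V W : lmodType k).

Lemma tensor_lift_pi (f : U -> V -> W) (s : seq (U * V)) : bilin f ->
  tensor_lift f (\pi_(U \ot V) s) = \sum_(p <- s) f p.1 p.2.
Proof.
move=> [fl fr]; rewrite /tensor_lift; move: (repr _) (tensor_reprK s) => r.
have fl0 v : f 0 v = 0.
  exact: lin0 (fl v).
elim=> {r s} [s|s t _ ->|s t r _ -> _ ->||||||] //=.
- by move=> s s' t t' _ IHs _ IHt; rewrite !big_cat /= IHs IHt.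
- by move=> s t; rewrite !big_cat /= addrC.
- move=> u u' v; rewrite !big_cons !big_nil !addr0 /=.
  by have := fl v 1 u u'; rewrite !scale1r.
- move=> u v v'; rewrite !big_cons !big_nil !addr0 /=.
  by have := fr u 1 v v'; rewrite !scale1r.
- move=> a u v; rewrite !big_seq1 /=.
  have := fl v a u 0; rewrite addr0 fl0 addr0 => ->.
  have fr0 := lin0 (fr u).
  by have := fr u a v 0; rewrite addr0 fr0 addr0 => ->.
- by move=> v; rewrite big_seq1 big_nil /= fl0.
Qed.

Lemma tensor_liftE (f : U -> V -> W) u v : bilin f ->
  tensor_lift f (u \ox v) = f u v.
Proof. by move=> bf; rewrite tensor_lift_pi // big_seq1. Qed.

Lemma tensor_lift_linear (f : U -> V -> W) : bilin f -> linear (tensor_lift f).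
Proof.
move=> bf a x y; have [s ->] := tensor_surj x; have [t ->] := tensor_surj y.
rewrite [a *: _]tensor_scaleE -tensor_pi_cat !tensor_lift_pi // big_cat big_map /=.
congr (_ + _); rewrite scaler_sumr; apply: eq_bigr => -[u v] _ /=.
have f0 := lin0 (bf.1 v); rewrite /= in f0.
by have := bf.1 v a u 0; rewrite addr0 f0 addr0.
Qed.

Lemma tensor_eq_lin (F G : U \ot V -> W) : linear F -> linear G ->
  (forall u v, F (u \ox v) = G (u \ox v)) -> F =1 G.
Proof.
move=> lF lG FG x; rewrite [x]tensor_sumE; elim: (repr x) => [|p s IH].
  by rewrite big_nil !lin0.
rewrite big_cons -[_ \ox _]scale1r lF lG FG; congr (_ + _); exact: IH.
Qed.

End TensorLift.

Notation "\sw_ ( x1 , x2 <- t ) F" := (tensor_lift (fun x1 x2 => F) t)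
  (at level 41, x1 binder, x2 binder, t at level 60, F at level 41,
   right associativity,
   format "'[' \sw_ ( x1 ,  x2  <-  t ) '/  '  F ']'") : ring_scope.

Section LinearityLemmas.
Variables (k : fieldType).
Implicit Types (U V W X : lmodType k).

Lemma lin_tensl U V W (F : W -> U) v : linear F -> linear (fun w => F w \ox (v : V)).
Proof. by move=> lF a x y; rewrite lF tensDl tensZl. Qed.
Lemma lin_tensr U V W (F : W -> V) u : linear F -> linear (fun w => (u : U) \ox F w).
Proof. by move=> lF a x y; rewrite lF tensDr tensZr. Qed.
Lemma lin_sw U V W X (f : X -> U -> V -> W) t :
  (forall u v, linear (fun x => f x u v)) -> linear (fun x => tensor_lift (f x) t).
Proof.
move=> lf a x y; rewrite /tensor_lift scaler_sumr -big_split.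
by apply: eq_bigr => p _; rewrite lf.
Qed.
Lemma lin_swr U V W X (f : U -> V -> W) (F : X -> U \ot V) :
  bilin f -> linear F -> linear (fun x => tensor_lift f (F x)).
Proof. by move=> bf lF a x y; rewrite lF tensor_lift_linear. Qed.
Lemma lin_comp U V W (F : V -> W) (G : U -> V) :
  linear F -> linear G -> linear (fun x => F (G x)).
Proof. by move=> lF lG a x y; rewrite lG lF. Qed.
Lemma lin_id U : linear (fun x : U => x). Proof. by []. Qed.
Lemma lin_scale U W (F : W -> k) (u : U) : scalar F -> linear (fun w => F w *: u).
Proof. by move=> lF a x y; rewrite lF scalerDl scalerA. Qed.
Lemma lin_scaler U W (F : W -> U) (a : k) : linear F -> linear (fun w => a *: F w).
Proof. by move=> lF b x y; rewrite lF scalerDr !scalerA mulrC. Qed.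
Lemma lin_can U V (F : {linear U -> V}) : linear F. Proof. exact: linearP. Qed.
Lemma scal_can U (F : {scalar U}) : scalar F. Proof. exact: linearP. Qed.

Lemma sw_lin U V W X (F : W -> X) (f : U -> V -> W) t : linear F ->
  F (\sw_(x1, x2 <- t) f x1 x2) = \sw_(x1, x2 <- t) F (f x1 x2).
Proof.
move=> lF; rewrite /tensor_lift.
elim: (repr t) => [|p s IH]; first by rewrite !big_nil lin0.
by rewrite !big_cons -IH -{1}[f _ _]scale1r lF scale1r.
Qed.

Lemma eq_sw U V W (f g : U -> V -> W) t : (forall u v, f u v = g u v) ->
  tensor_lift f t = tensor_lift g t.
Proof. by move=> fg; apply: eq_bigr. Qed.

Lemma exchange_sw U V U' V' W (f : U -> V -> U' -> V' -> W) t t' :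
  \sw_(u, v <- t) \sw_(u', v' <- t') f u v u' v' =
  \sw_(u', v' <- t') \sw_(u, v <- t) f u v u' v'.
Proof. exact: exchange_big. Qed.

End LinearityLemmas.

Ltac linear_tac :=
  by repeat first [ assumption | exact: lin_id | exact: lin_can | exact: scal_can
    | apply: lin_sw => ? ? | apply: lin_tensl | apply: lin_tensr
    | apply: lin_scale | apply: lin_scaler
    | apply: lin_swr; [split=> ? |] | apply: tensor_lift_linear; split=> ? ].
Ltac bilin_tac := split=> ?; linear_tac.

Section TensorMaps.
Variable k : fieldType.
Implicit Types U V W : lmodType k.

Definition tensor_map U V U' V' (f : U -> U') (g : V -> V') (x : U \ot V) :
    U' \ot V' :=
  \sw_(u, v <- x) f u \ox g v.

Definition tensor_swap U V (x : U \ot V) : V \ot U := \sw_(u, v <- x) v \ox u.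

Definition tensor_assoc U V W (x : (U \ot V) \ot W) : U \ot (V \ot W) :=
  \sw_(t, w <- x) \sw_(u, v <- t) u \ox (v \ox w).

Fact tensor_map_linear U V U' V' (f : {linear U -> U'}) (g : {linear V -> V'}) :
  linear (tensor_map f g).
Proof. by apply: tensor_lift_linear; bilin_tac. Qed.
HB.instance Definition _ U V U' V' (f : {linear U -> U'}) (g : {linear V -> V'}) :=
  GRing.isLinear.Build k (U \ot V) (U' \ot V') *:%R (tensor_map f g)
    (tensor_map_linear f g).

Fact tensor_swap_linear U V : linear (@tensor_swap U V).
Proof. by apply: tensor_lift_linear; bilin_tac. Qed.
HB.instance Definition _ U V :=
  GRing.isLinear.Build k (U \ot V) (V \ot U) *:%R (@tensor_swap U V)
    (@tensor_swap_linear U V).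

Fact tensor_assoc_linear U V W : linear (@tensor_assoc U V W).
Proof. by apply: tensor_lift_linear; bilin_tac. Qed.
HB.instance Definition _ U V W :=
  GRing.isLinear.Build k ((U \ot V) \ot W) (U \ot (V \ot W)) *:%R
    (@tensor_assoc U V W) (@tensor_assoc_linear U V W).

Lemma tensor_mapE U V U' V' (f : {linear U -> U'}) (g : {linear V -> V'}) u v :
  tensor_map f g (u \ox v) = f u \ox g v.
Proof. by apply: tensor_liftE; bilin_tac. Qed.
Lemma tensor_swapE U V (u : U) (v : V) : tensor_swap (u \ox v) = v \ox u.
Proof. by apply: tensor_liftE; bilin_tac. Qed.
Lemma tensor_assoc_sw U V W (t : U \ot V) (w : W) :
  tensor_assoc (t \ox w) = \sw_(u, v <- t) u \ox (v \ox w).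
Proof. by apply: tensor_liftE; bilin_tac. Qed.
Lemma tensor_assocE U V W (u : U) (v : V) (w : W) :
  tensor_assoc ((u \ox v) \ox w) = u \ox (v \ox w).
Proof. by rewrite tensor_assoc_sw; apply: tensor_liftE; bilin_tac. Qed.

End TensorMaps.

Record coalgebra (k : fieldType) (V : lmodType k) := Coalgebra {
  comul : {linear V -> V \ot V};
  counit : {scalar V};
  comulA : forall x, tensor_assoc (tensor_map comul idfun (comul x)) =
                     tensor_map idfun comul (comul x);
  comul1l : forall x, \sw_(x1, x2 <- comul x) counit x1 *: x2 = x;
  comul1r : forall x, \sw_(x1, x2 <- comul x) counit x2 *: x1 = x
}.

Section CoalgebraTheory.
Variable k : fieldType.

Lemma comulA_sw (V W : lmodType k) (C : coalgebra V) (g : V -> V -> V -> W) x :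
  (forall u v, linear (g u v)) -> (forall u w, linear (g u ^~ w)) ->
  (forall v w, linear (fun u => g u v w)) ->
  \sw_(x1, x2 <- comul C x) \sw_(y1, y2 <- comul C x1) g y1 y2 x2 =
  \sw_(x1, x2 <- comul C x) \sw_(y1, y2 <- comul C x2) g x1 y1 y2.
Proof.
move=> l3 l2 l1.
have bg u : bilin (g u) by split=> ?; [exact: l2|exact: l3].
pose h u t := tensor_lift (g u) t.
have bh : bilin h.
  split=> ?; first by apply: lin_sw => *; exact: l1.
  by apply: tensor_lift_linear.
have := congr1 (tensor_lift h) (comulA C x).
rewrite /tensor_map /=.
rewrite [X in _ = X -> _](sw_lin _ _ (tensor_lift_linear bh)).
have -> : \sw_(x1, x2 <- comul C x) tensor_lift h (x1 \ox comul C x2) =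
   \sw_(x1, x2 <- comul C x) \sw_(y1, y2 <- comul C x2) g x1 y1 y2.
  by apply: eq_sw => u v; rewrite tensor_liftE.
move=> <-.
have lA := @tensor_assoc_linear k V V V.
rewrite (sw_lin _ _ lA) (sw_lin _ _ (tensor_lift_linear bh)).
apply: eq_sw => u v.
rewrite tensor_assoc_sw (sw_lin _ _ (tensor_lift_linear bh)).
by apply: eq_sw => ? ?; rewrite tensor_liftE // /h tensor_liftE.
Qed.

(* The co-opposite coalgebra, on the same space. *)
Section Cop.
Variables (V : lmodType k) (C : coalgebra V).

Definition cop_comul : {linear V -> V \ot V} := @tensor_swap k V V \o comul C.

Lemma cop_sw (W : lmodType k) (f : V -> V -> W) x : bilin f ->
  \sw_(x1, x2 <- cop_comul x) f x1 x2 = \sw_(x1, x2 <- comul C x) f x2 x1.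
Proof.
move=> bf; rewrite /= /tensor_swap (sw_lin _ _ (tensor_lift_linear bf)).
by apply: eq_sw => u v; rewrite tensor_liftE.
Qed.

Fact cop_comulA x : tensor_assoc (tensor_map cop_comul idfun (cop_comul x)) =
                    tensor_map idfun cop_comul (cop_comul x).
Proof.
rewrite /tensor_map !cop_sw; try by bilin_tac.
rewrite (sw_lin _ _ (@tensor_assoc_linear k V V V)) /=.
transitivity (\sw_(x1, x2 <- comul C x) \sw_(y1, y2 <- comul C x2)
    (y2 \ox (y1 \ox x1))).
  apply: eq_sw => u v; rewrite /tensor_swap.
  rewrite (sw_lin _ _ (lin_comp (@tensor_assoc_linear k V V V)
    (lin_tensl u (@lin_id _ _)))).
  by apply: eq_sw => ? ?; rewrite tensor_assocE.
rewrite -comulA_sw; [|by move=> *; linear_tac..].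
apply: eq_sw => u v; rewrite /tensor_swap.
by rewrite (sw_lin _ _ (lin_tensr v (@lin_id _ _))).
Qed.

Fact cop_comul1l x : \sw_(x1, x2 <- cop_comul x) counit C x1 *: x2 = x.
Proof. by rewrite cop_sw ?comul1r //; bilin_tac. Qed.
Fact cop_comul1r x : \sw_(x1, x2 <- cop_comul x) counit C x2 *: x1 = x.
Proof. by rewrite cop_sw ?comul1l //; bilin_tac. Qed.

Definition cop : coalgebra V := Coalgebra cop_comulA cop_comul1l cop_comul1r.
End Cop.

Section TensorCoalgebra.
Variables (V W : lmodType k) (C : coalgebra V) (D : coalgebra W).

Let comul2 (v : V) (w : W) :=
  \sw_(v1, v2 <- comul C v) \sw_(w1, w2 <- comul D w)
    ((v1 \ox w1) \ox (v2 \ox w2)).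
Definition tensor_comul (x : V \ot W) : (V \ot W) \ot (V \ot W) :=
  \sw_(v, w <- x) \sw_(v1, v2 <- comul C v) \sw_(w1, w2 <- comul D w)
    ((v1 \ox w1) \ox (v2 \ox w2)).
Definition tensor_counit (x : V \ot W) : k :=
  \sw_(v, w <- x) (counit C v * counit D w : k^o).

Fact comul2_bilin : bilin comul2.
Proof. bilin_tac. Qed.
Fact tensor_comul_linear : linear tensor_comul.
Proof. by apply: tensor_lift_linear; exact: comul2_bilin. Qed.
HB.instance Definition _ := GRing.isLinear.Build k (V \ot W)
  ((V \ot W) \ot (V \ot W)) *:%R tensor_comul tensor_comul_linear.

Fact counit2_bilin : bilin (fun v w => counit C v * counit D w : k^o).
Proof.
split=> [w a x y|v a x y]; rewrite linearP /=.
  by rewrite mulrDl /= -mulrA.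
by rewrite mulrDr /= mulrCA.
Qed.
Fact tensor_counit_linear : scalar tensor_counit.
Proof. exact (tensor_lift_linear counit2_bilin). Qed.
HB.instance Definition _ := GRing.isLinear.Build k (V \ot W)
  k *%R tensor_counit tensor_counit_linear.

Lemma tensor_comulE v w : tensor_comul (v \ox w) =
  \sw_(v1, v2 <- comul C v) \sw_(w1, w2 <- comul D w)
    ((v1 \ox w1) \ox (v2 \ox w2)).
Proof. exact: tensor_liftE comul2_bilin. Qed.
Lemma tensor_counitE v w : tensor_counit (v \ox w) = counit C v * counit D w.
Proof. exact: tensor_liftE counit2_bilin. Qed.

Lemma tensor_sw (X : lmodType k) (f : V \ot W -> V \ot W -> X) v w : bilin f ->
  \sw_(x1, x2 <- tensor_comul (v \ox w)) f x1 x2 =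
  \sw_(v1, v2 <- comul C v) \sw_(w1, w2 <- comul D w)
    f (v1 \ox w1) (v2 \ox w2).
Proof.
move=> bf; rewrite tensor_comulE (sw_lin _ _ (tensor_lift_linear bf)).
apply: eq_sw => v1 v2; rewrite (sw_lin _ _ (tensor_lift_linear bf)).
by apply: eq_sw => w1 w2; rewrite tensor_liftE.
Qed.

Fact tensor_comulA x :
  tensor_assoc (tensor_map tensor_comul idfun (tensor_comul x)) =
  tensor_map idfun tensor_comul (tensor_comul x).
Proof.
move: x; apply: tensor_eq_lin => [||v w].
- exact: lin_comp (@tensor_assoc_linear k _ _ _)
    (lin_comp (tensor_map_linear tensor_comul idfun) tensor_comul_linear).
- exact: lin_comp (tensor_map_linear idfun tensor_comul) tensor_comul_linear.
rewrite {1 2}/tensor_map !tensor_sw; try by bilin_tac.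
have lA := @tensor_assoc_linear k (V \ot W) (V \ot W) (V \ot W).
transitivity (\sw_(v1, v2 <- comul C v) \sw_(u1, u2 <- comul C v1)
  \sw_(w1, w2 <- comul D w) \sw_(z1, z2 <- comul D w1)
    ((u1 \ox z1) \ox ((u2 \ox z2) \ox (v2 \ox w2)))).
  rewrite (sw_lin _ _ lA); apply: eq_sw => v1 v2; rewrite (sw_lin _ _ lA) /=.
  rewrite exchange_sw; apply: eq_sw => w1 w2; rewrite tensor_comulE.
  have lB := lin_comp lA (lin_tensl (v2 \ox w2) (@lin_id _ _)).
  rewrite (sw_lin _ _ lB); apply: eq_sw => u1 u2.
  by rewrite (sw_lin _ _ lB); apply: eq_sw => z1 z2; rewrite tensor_assocE.
rewrite (@comulA_sw _ _ C (fun u1 u2 v2 => \sw_(w1, w2 <- comul D w)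
  \sw_(z1, z2 <- comul D w1) ((u1 \ox z1) \ox ((u2 \ox z2) \ox (v2 \ox w2)))));
  try by move=> *; linear_tac.
apply: eq_sw => v1 v2 /=.
transitivity (\sw_(w1, w2 <- comul D w) \sw_(u1, u2 <- comul C v2)
  \sw_(z1, z2 <- comul D w2) ((v1 \ox w1) \ox ((u1 \ox z1) \ox (u2 \ox z2)))).
  rewrite [RHS]exchange_sw; apply: eq_sw => u1 u2.
  rewrite (@comulA_sw _ _ D (fun w1 z1 z2 =>
    (v1 \ox w1) \ox ((u1 \ox z1) \ox (u2 \ox z2)))) //; move=> *; linear_tac.
apply: eq_sw => w1 w2; rewrite tensor_comulE.
have lB := lin_tensr (v1 \ox w1) (@lin_id k ((V \ot W) \ot (V \ot W))).
by rewrite (sw_lin _ _ lB); apply: eq_sw => ? ?; rewrite (sw_lin _ _ lB).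
Qed.

Fact tensor_comul1l x : \sw_(x1, x2 <- tensor_comul x) tensor_counit x1 *: x2 = x.
Proof.
have b : bilin (fun x1 x2 : V \ot W => tensor_counit x1 *: x2) by bilin_tac.
move: x; apply: tensor_eq_lin => [||v w] //.
  exact: lin_comp (tensor_lift_linear b) tensor_comul_linear.
rewrite tensor_sw //.
transitivity ((\sw_(v1, v2 <- comul C v) counit C v1 *: v2) \ox w : V \ot W);
  last by rewrite comul1l.
have lw := lin_tensl w (@lin_id k V); rewrite (sw_lin _ _ lw).
apply: eq_sw => v1 v2.
transitivity ((counit C v1 *: v2) \ox
    (\sw_(w1, w2 <- comul D w) counit D w1 *: w2) : V \ot W);
  last by rewrite comul1l.
have lv := lin_tensr (counit C v1 *: v2) (@lin_id k W); rewrite (sw_lin _ _ lv).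
apply: eq_sw => w1 w2.
by rewrite tensor_counitE tensZl tensZr scalerA.
Qed.

Fact tensor_comul1r x : \sw_(x1, x2 <- tensor_comul x) tensor_counit x2 *: x1 = x.
Proof.
have b : bilin (fun x1 x2 : V \ot W => tensor_counit x2 *: x1) by bilin_tac.
move: x; apply: tensor_eq_lin => [||v w] //.
  exact: lin_comp (tensor_lift_linear b) tensor_comul_linear.
rewrite tensor_sw //.
transitivity ((\sw_(v1, v2 <- comul C v) counit C v2 *: v1) \ox w : V \ot W);
  last by rewrite comul1r.
have lw := lin_tensl w (@lin_id k V); rewrite (sw_lin _ _ lw).
apply: eq_sw => v1 v2.
transitivity ((counit C v2 *: v1) \ox
    (\sw_(w1, w2 <- comul D w) counit D w2 *: w1) : V \ot W);
  last by rewrite comul1r.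
have lv := lin_tensr (counit C v2 *: v1) (@lin_id k W); rewrite (sw_lin _ _ lv).
apply: eq_sw => w1 w2.
by rewrite tensor_counitE tensZl tensZr scalerA.
Qed.

Definition tensor_coalgebra : coalgebra (V \ot W) :=
  Coalgebra tensor_comulA tensor_comul1l tensor_comul1r.
End TensorCoalgebra.
End CoalgebraTheory.

Definition coalgebra_morphism (k : fieldType) (V W : lmodType k)
    (C : coalgebra V) (D : coalgebra W) (F : V -> W) : Prop :=
  [/\ linear F,
      forall x, comul D (F x) = tensor_map F F (comul C x)
    & forall x, counit D (F x) = counit C x].

(* A Hopf algebra structure on the algebra H; the antipode need not be         *)
(* bijective.                                                                 *)
Record hopf_algebra (k : fieldType) (H : algType k) := HopfAlgebra {
  hopf_coalgebra :> coalgebra H;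
  comul_one : comul hopf_coalgebra 1 = 1 \ox 1;
  comulM : forall x y, comul hopf_coalgebra (x * y) =
    \sw_(x1, x2 <- comul hopf_coalgebra x) \sw_(y1, y2 <- comul hopf_coalgebra y)
      ((x1 * y1) \ox (x2 * y2));
  counit_one : counit hopf_coalgebra 1 = 1;
  counitM : forall x y, counit hopf_coalgebra (x * y) =
    counit hopf_coalgebra x * counit hopf_coalgebra y;
  antipode : {linear H -> H};
  antipodel : forall x, \sw_(x1, x2 <- comul hopf_coalgebra x) antipode x1 * x2 =
    (counit hopf_coalgebra x)%:A;
  antipoder : forall x, \sw_(x1, x2 <- comul hopf_coalgebra x) x1 * antipode x2 =
    (counit hopf_coalgebra x)%:A
}.

Section QCycleCoalgebra.
Variables (k : fieldType) (H : lmodType k) (C : coalgebra H).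
Variables (dot colon : {linear H \ot H -> H}).
Local Notation "x \d y" := (dot (x \ox y)) (at level 40, left associativity).
Local Notation "x \c y" := (colon (x \ox y)) (at level 40, left associativity).
Local Notation Delta := (comul C).
Local Notation eps := (counit C).

(* x \ox y |-> (y_(1) : x_(2)) \ox (x_(1) . y_(2)) *)
Definition q_magma_map (t : H \ot H) : H \ot H :=
  \sw_(x, y <- t) \sw_(x1, x2 <- Delta x) \sw_(y1, y2 <- Delta y)
    ((y1 \c x2) \ox (x1 \d y2)).

(* x \ox y |-> (x . y_(1)) \ox y_(2) *)
Definition left_regular_map (t : H \ot H) : H \ot H :=
  \sw_(x, y <- t) \sw_(y1, y2 <- Delta y) ((x \d y1) \ox y2).

Definition q_magma_coalgebra : Prop :=
  [/\ forall x y, eps (x \d y) = eps x * eps y,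
      forall x y, eps (x \c y) = eps x * eps y
    & coalgebra_morphism (tensor_coalgebra C (cop C)) (tensor_coalgebra (cop C) C)
        q_magma_map].

Definition left_regular : Prop := bijective left_regular_map.

Definition q_cycle_coalgebra : Prop :=
  [/\ q_magma_coalgebra,
      left_regular,
      forall x y z,
        \sw_(y1, y2 <- Delta y) ((x \d y1) \d (z \c y2)) =
        \sw_(z1, z2 <- Delta z) ((x \d z2) \d (y \d z1)),
      forall x y z,
        \sw_(y1, y2 <- Delta y) ((x \d y1) \c (z \d y2)) =
        \sw_(z1, z2 <- Delta z) ((x \c z2) \d (y \c z1))
    & forall x y z,
        \sw_(y1, y2 <- Delta y) ((x \c y1) \c (z \c y2)) =
        \sw_(z1, z2 <- Delta z) ((x \c z2) \c (y \d z1))].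

End QCycleCoalgebra.

Section HopfQBrace.
Variables (k : fieldType) (H : algType k) (HH : hopf_algebra H).
Variables (dot colon : {linear H \ot H -> H}).
Local Notation "x \d y" := (dot (x \ox y)) (at level 40, left associativity).
Local Notation "x \c y" := (colon (x \ox y)) (at level 40, left associativity).
Local Notation Delta := (comul HH).

Definition right_op_module (op : {linear H \ot H -> H}) : Prop :=
  (forall h, op (h \ox 1) = h) /\
  (forall h m l, op (h \ox (m * l)) = op (op (h \ox l) \ox m)).

Definition hopf_q_brace : Prop :=
  [/\ q_cycle_coalgebra HH dot colon,
      right_op_module dot,
      right_op_module colon,
      forall h m l, (h * m) \d l =
        \sw_(l1, l2 <- Delta l) \sw_(m1, m2 <- Delta m)
          (h \d (l1 \c m2)) * (m1 \d l2)
    & forall h m l, (h * m) \c l =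
        \sw_(l1, l2 <- Delta l) \sw_(m1, m2 <- Delta m)
          (h \c (l1 \d m2)) * (m1 \c l2)].

Definition times (h l : H) : H := \sw_(h1, h2 <- Delta h) (l \d h1) * h2.
Definition boxtimes (h l : H) : H := \sw_(h1, h2 <- Delta h) (l \c h2) * h1.
Local Notation "h \x l" := (times h l) (at level 40, left associativity).
Local Notation "h \bx l" := (boxtimes h l) (at level 40, left associativity).

Definition eq_a1 : Prop := forall h m l, h \d (m * l) = (h \d l) \d m.
Definition eq_a2 : Prop := forall h m l,
  (m \bx l) \d h = \sw_(h1, h2 <- Delta h) ((m \d h2) \bx (l \d h1)).
Definition eq_a3 : Prop := forall h m l, h \d (m \x l) = h \d (l \bx m).
Definition eq_b1 : Prop := forall h m l, h \c (m * l) = (h \c l) \c m.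
Definition eq_b2 : Prop := forall h m l,
  (m \x l) \c h = \sw_(h1, h2 <- Delta h) ((m \c h1) \x (l \c h2)).
Definition eq_b3 : Prop := forall h m l, h \c (m \x l) = h \c (l \bx m).

End HopfQBrace.

(* Main.v *)
Require Import Defs.
From HB Require Import structures.
From mathcomp Require Import all_boot all_order all_algebra zify.
Set Implicit Arguments.
Unset Strict Implicit.
Unset Printing Implicit Defensive.
Import GRing.Theory.
Local Open Scope ring_scope.

(** Every identity of the statement equates two sums over iterated
    comultiplications in which each component of each variable is used once, and
    both operations [x \d y], [x \c y] are coalgebra maps from [H \ot H^cop].
    Such sums are therefore determined by terms with numbered leaves, where
    coassociativity, the counit and the comultiplication of a compound term
    amount to renumbering ([sem_comp]).  Replacing a pattern by an equivalent one
    inside an expression gives an equivalent expression ([rewritesP]), and the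
    result is computed; an identity is proved by displaying intermediate terms.

    A q-magma coalgebra satisfies, besides the comultiplicativity of both
    operations, the exchange identity [q_magma_exchange]
      x1.y2 (x) y1:x2 = x2.y1 (x) y2:x1,
    where x.y and x:y are the two operations, x1, x2, ... the components of x
    and (x) the tensor product.  In a Hopf q-brace, the two distributivity laws,
    the three q-cycle laws and the exchange identity give [eq_a2], [eq_a3], [eq_b2],
    [eq_b3] and both associativities in one to three steps each.

    Conversely, [eq_a3] and [eq_b3] are the first and third q-cycle laws.
    Associativity of [times], after cancelling a last factor with the antipode S, is the law for
    hm.l restricted to the elements z.y1 (x) y2 of H (x) H, so that left regularity
    yields the whole law.  The inverse of left regularity would be
    x (x) y |-> x.S^-1(y1) (x) y2, but S need not be invertible; the heart of the
    proof is to construct an inverse from S alone.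
    - The law for hm.l is already known for m = S(w) ([dot_mul_antipode]), and
      associativity of [boxtimes] gives the law for hm:l when l = S(w)
      ([colon_antipode]).
    - Put lam_y(x) = x1.(y:S(x2)).  By the exchange identity lam is a coalgebra map
      ([lam_comul]), so that the first fact gives S(lam_y(x)) = S(x).y
      ([antipode_lam]); with the second, lam is a left action of H ([lam_action]).
    - The twisted operators rho_y(x) = x2.((y:SS(x1)):S(x3)) form a left action as
      well ([rho_action]), so rho_(S(y)) inverts rho_y.
    - By the exchange identity, x (x) y |-> x.y1 (x) y2 is the composite of the
      invertible map x (x) y |-> x2 (x) y:(S(x1)x3) and of
      x (x) y |-> rho_(y2)(x) (x) y1 ([left_regular_factor]).
    The law for hm:l with general l follows from the case l = S(w): both sides are
    actions of l, the right-hand one because of the law for hm.l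
    ([brace_colon_of_assoc]).  With [eq_b2] it gives the second q-cycle law. *)

(** * Multilinear functions and iterated comultiplications *)

Lemma linZ (k : fieldType) (U W : lmodType k) (F : U -> W) a u :
  linear F -> F (a *: u) = a *: F u.
Proof. by move=> lF; rewrite -[a *: u]addr0 lF (lin0 lF) addr0. Qed.

(** A function of n arguments is encoded on sequences of length n, because the
    arities are computed from expressions. *)
Definition multilinear (k : fieldType) (V W : lmodType k) n (f : seq V -> W) :=
  forall s1 s2, (size s1 + (size s2).+1)%N = n -> linear (fun x => f (s1 ++ x :: s2)).

Section Iterated.
Variables (k : fieldType) (V : lmodType k).
Implicit Types (C : coalgebra V) (U W : lmodType k).

Lemma multilinear_cons W n (f : seq V -> W) x :
  multilinear n.+1 f -> multilinear n (fun s => f (x :: s)).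
Proof. by move=> lf s1 s2 e; apply: (lf (x :: s1)); rewrite /= addSn e. Qed.

Lemma multilinear_head W n (f : seq V -> W) s :
  multilinear n.+1 f -> size s = n -> linear (fun x => f (x :: s)).
Proof. by move=> lf e; apply: (lf [::]); rewrite /= e. Qed.

Lemma multilinear_catl W n m (f : seq V -> W) t :
  multilinear (n + m) f -> size t = m -> multilinear n (fun s => f (s ++ t)).
Proof.
move=> lf e s1 s2 e1 a u v; rewrite -!catA /=.
by apply: (lf s1 (s2 ++ t)); rewrite size_cat e -e1 !(addSn, addnS) ?addnA.
Qed.

Lemma multilinear_catr W n m (f : seq V -> W) s :
  multilinear (n + m) f -> size s = n -> multilinear m (fun t => f (s ++ t)).
Proof.
move=> lf e s1 s2 e1 a u v; rewrite !catA.
by apply: (lf (s ++ s1) s2); rewrite size_cat e -e1 addnA.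
Qed.

Lemma multilinear_rev W n (f : seq V -> W) :
  multilinear n f -> multilinear n (fun s => f (rev s)).
Proof.
move=> lf s1 s2 e a u v; rewrite !rev_cat !rev_cons !cat_rcons.
by apply: lf; rewrite !size_rev -e addnC addSn addnS.
Qed.

(** The Sweedler sum of [f [:: x_(1); ...; x_(n)]], which is [eps x *: f [::]] for
    n = 0.  Ending the recursion at the counit makes [n] additive without
    exceptions. *)
Fixpoint iter_sw C W n (x : V) (f : seq V -> W) : W :=
  if n is n'.+1 then
    \sw_(x1, x2 <- comul C x) iter_sw C n' x2 (fun s => f (x1 :: s))
  else counit C x *: f [::].

Variable C : coalgebra V.
Local Notation isw := (iter_sw C).

Lemma eq_iter_sw W n x (f g : seq V -> W) :
  (forall s, size s = n -> f s = g s) -> isw n x f = isw n x g.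
Proof.
elim: n x f g => [|n IH] x f g fg /=; first by rewrite fg.
by apply: eq_sw => u v; apply: IH => s e; apply: fg; rewrite /= e.
Qed.

Lemma iter_sw_par U W n x (f : U -> seq V -> W) :
  (forall s, size s = n -> linear (f^~ s)) -> linear (fun a => isw n x (f a)).
Proof.
elim: n x f => [|n IH] x f lf /=; first by apply: lin_scaler; apply: lf.
by apply: lin_sw => u v; apply: IH => s e; apply: (lf (u :: s)); rewrite /= e.
Qed.

Lemma iter_sw_bilin W n (f : seq V -> W) : multilinear n f -> linear (fun x => isw n x f).
Proof.
elim: n f => [|n IH] f lf /=; first by apply: lin_scale; apply: scal_can.
apply: lin_swr; last exact: lin_can.
split=> [v|u]; first by apply: iter_sw_par => s; apply: multilinear_head.
exact/IH/multilinear_cons.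
Qed.

Lemma iter_sw_pull U W n x (F : U -> W) (f : seq V -> U) : linear F ->
  F (isw n x f) = isw n x (fun s => F (f s)).
Proof.
move=> lF; elim: n x f => [|n IH] x f /=.
  exact: linZ.
by rewrite (sw_lin _ _ lF); apply: eq_sw => u v; apply: IH.
Qed.

Lemma sw_iter_sw (A B W : lmodType k) n x (t : A \ot B) (f : A -> B -> seq V -> W) :
  \sw_(a, b <- t) isw n x (f a b) = isw n x (fun s => \sw_(a, b <- t) f a b s).
Proof.
elim: n x f => [|n IH] x f /=.
  by rewrite (sw_lin _ _ (lin_scaler _ (@lin_id k W))).
by rewrite exchange_sw; apply: eq_sw => u v; apply: IH.
Qed.

Lemma iter_sw1 W x (f : seq V -> W) : multilinear 1 f -> isw 1 x f = f [:: x].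
Proof.
move=> lf; have l1 : linear (fun u => f [:: u]) by apply: (lf [::] [::]).
rewrite /= -[in RHS](comul1r C x) (sw_lin _ _ l1); apply: eq_sw => u v.
exact/esym/(linZ _ _ l1).
Qed.

(** Coassociativity: n + m components are those of [x_(1)] followed by those of
    [x_(2)]. *)
Lemma iter_sw_cat W n m x (f : seq V -> W) : multilinear (n + m) f ->
  isw (n + m) x f =
  \sw_(x1, x2 <- comul C x) isw n x1 (fun s => isw m x2 (fun t => f (s ++ t))).
Proof.
elim: n x f => [|n IH] x f lf /=.
  have le := iter_sw_bilin lf; rewrite -[in LHS](comul1l C x) (sw_lin _ _ le).
  by apply: eq_sw => u v; exact: (linZ _ _ le).
rewrite (@comulA_sw _ _ _ C (fun y1 y2 x2 => isw n y2 (fun s =>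
  isw m x2 (fun t => f (y1 :: s ++ t))))).
- by apply: eq_sw => u v; rewrite IH //; apply: multilinear_cons lf.
- move=> u v; apply: iter_sw_par => s e; apply: iter_sw_bilin.
  by apply: (multilinear_catr (s := u :: s)) lf _; rewrite /= e.
- move=> u w; apply: (iter_sw_bilin (f := fun s => isw m w (fun t => f (u :: s ++ t)))).
  move=> s1 s2 e; apply: iter_sw_par => t et a v v'; rewrite -!catA /=.
  by apply: (lf (u :: s1) (s2 ++ t)); rewrite size_cat /= et -e !(addSn, addnS) addnA.
- move=> v w; apply: iter_sw_par => s e; apply: iter_sw_par => t et.
  by apply: multilinear_head lf _; rewrite size_cat e et.
Qed.

End Iterated.

Section MultiVariable.
Variables (k : fieldType) (V : lmodType k) (C : coalgebra V).
Implicit Types (U W : lmodType k).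
Local Notation isw := (iter_sw C).

Lemma iter_sw_exch W n m x y (f : seq V -> seq V -> W) :
  isw n x (fun s => isw m y (f s)) = isw m y (fun t => isw n x (f^~ t)).
Proof.
elim: n x f => [|n IH] x f /=.
  by rewrite (iter_sw_pull _ _ _ _ (lin_scaler _ (@lin_id k W))).
by rewrite -sw_iter_sw; apply: eq_sw => u v; rewrite IH.
Qed.

(** Comultiplies several variables; their components are listed in one sequence,
    so that a component is designated by its position. *)
Fixpoint msw W (xs : seq V) (ns : seq nat) (f : seq V -> W) : W :=
  match xs, ns with
  | x :: xs', n :: ns' => isw n x (fun s => msw xs' ns' (fun t => f (s ++ t)))
  | _, _ => f [::]
  end.

Lemma eq_msw W xs ns (f g : seq V -> W) : size xs = size ns ->
  (forall s, size s = sumn ns -> f s = g s) -> msw xs ns f = msw xs ns g.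
Proof.
elim: xs ns f g => [|x xs IH] [|n ns] f g //= => [_|[e]] fg; first exact: fg.
by apply: eq_iter_sw => s es; apply: IH => // t et; apply: fg; rewrite size_cat es et.
Qed.

Lemma msw_par U W xs ns (f : U -> seq V -> W) : size xs = size ns ->
  (forall s, size s = sumn ns -> linear (f^~ s)) ->
  linear (fun a => msw xs ns (f a)).
Proof.
elim: xs ns f => [|x xs IH] [|n ns] f //= => [_|[e]] lf; first exact: lf.
apply: iter_sw_par => s es; apply: IH => // t et.
by apply: (lf (s ++ t)); rewrite size_cat es et.
Qed.

Lemma msw_mlin W ns (f : seq V -> W) :
  multilinear (sumn ns) f -> multilinear (size ns) (fun xs => msw xs ns f).
Proof.
elim: ns f => [|n ns IH] f lf s1 s2 /=; first by rewrite addnS.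
case: s1 => [|x s1] /= [e].
  apply: iter_sw_bilin => t1 t2 et; apply: msw_par => // s es a u v.
  rewrite -!catA /=; apply: (lf t1 (t2 ++ s)).
  by rewrite size_cat es -et !(addSn, addnS) ?addnA.
apply: iter_sw_par => s es; apply: (IH (fun t => f (s ++ t))) => //.
exact: multilinear_catr lf _.
Qed.

Lemma msw_pull U W xs ns (F : U -> W) (f : seq V -> U) : linear F ->
  F (msw xs ns f) = msw xs ns (fun s => F (f s)).
Proof.
move=> lF; elim: xs ns f => [|x xs IH] [|n ns] f //=.
by rewrite (iter_sw_pull _ _ _ _ lF); apply: eq_iter_sw => s _; apply: IH.
Qed.

Lemma iter_sw_msw W n x xs ns (f : seq V -> seq V -> W) :
  isw n x (fun s => msw xs ns (f s)) = msw xs ns (fun t => isw n x (f^~ t)).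
Proof.
elim: xs ns f => [|y xs IH] [|m ns] f //=.
by rewrite iter_sw_exch; apply: eq_iter_sw => s _; apply: IH.
Qed.

Lemma msw_exch W xs ns ys ms (f : seq V -> seq V -> W) :
  msw xs ns (fun s => msw ys ms (f s)) = msw ys ms (fun t => msw xs ns (f^~ t)).
Proof.
elim: xs ns f => [|x xs IH] [|n ns] f //=.
by rewrite -iter_sw_msw; apply: eq_iter_sw => s _; rewrite IH.
Qed.

Lemma msw_cat W xs ys ns ms (f : seq V -> W) : size xs = size ns ->
  msw (xs ++ ys) (ns ++ ms) f =
  msw xs ns (fun s => msw ys ms (fun t => f (s ++ t))).
Proof.
elim: xs ns f => [|x xs IH] [|n ns] f //= [e].
apply: eq_iter_sw => s _; rewrite IH //; apply: eq_msw => // t _.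
congr msw; apply: boolp.funext => u; by rewrite catA.
Qed.

Lemma msw_ones W ys (f : seq V -> W) :
  multilinear (size ys) f -> msw ys (nseq (size ys) 1%N) f = f ys.
Proof.
elim: ys f => [|y ys IH] f lf //.
transitivity (isw 1 y (fun s => msw ys (nseq (size ys) 1%N) (fun t => f (s ++ t)))) => //.
rewrite iter_sw1; first by apply: (IH (fun t => f (y :: t))); apply: multilinear_cons lf.
move=> [|? [|? ?]] [|? ?] //= _; apply: msw_par => [|s]; first by rewrite size_nseq.
by rewrite sumn_nseq mul1n => es; apply: (multilinear_head lf es).
Qed.

(** Coassociativity in bulk: comultiplying each component of an iterated
    comultiplication again gives an iterated comultiplication. *)
Lemma iter_sw_msw_assoc W x ms (f : seq V -> W) : multilinear (sumn ms) f ->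
  isw (size ms) x (fun s => msw s ms f) = isw (sumn ms) x f.
Proof.
elim: ms x f => [|m ms IH] x f lf //=.
rewrite iter_sw_cat //; apply: eq_sw => u v.
rewrite iter_sw_exch; apply: eq_iter_sw => s es; apply: IH.
exact: multilinear_catr lf _.
Qed.

Lemma msw_assoc W xs ns ms (f : seq V -> W) :
  size xs = size ns -> sumn ns = size ms -> multilinear (sumn ms) f ->
  msw xs ns (fun s => msw s ms f) = msw xs [seq sumn r | r <- reshape ns ms] f.
Proof.
elim: xs ns ms f => [|x xs IH] [|n ns] ms f //= [e] em lf.
have e1 : size (take n ms) = n by rewrite size_takel // -em leq_addr.
have e2 : sumn ns = size (drop n ms) by rewrite size_drop -em addKn.
have ems : sumn ms = (sumn (take n ms) + sumn (drop n ms))%N.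
  by rewrite -sumn_cat cat_take_drop.
pose F s := msw xs [seq sumn r | r <- reshape ns (drop n ms)] (fun t => f (s ++ t)).
have szr : size xs = size [seq sumn r | r <- reshape ns (drop n ms)].
  by rewrite size_map size_reshape.
have smr : sumn [seq sumn r | r <- reshape ns (drop n ms)] = sumn (drop n ms).
  by rewrite -sumn_flatten reshapeKr // e2.
rewrite -[RHS](iter_sw_msw_assoc (ms := take n ms) x (f := F)).
  rewrite e1; apply: eq_iter_sw => s es.
  rewrite -[in LHS](cat_take_drop n ms) /F.
  transitivity (msw xs ns (fun t => msw s (take n ms) (fun a =>
     msw t (drop n ms) (fun b => f (a ++ b))))).
    by apply: eq_msw => // t et; rewrite msw_cat // e1.
  rewrite msw_exch; apply: eq_msw; first by rewrite es e1.
  move=> a ea; rewrite IH //.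
  by apply: multilinear_catr ea; rewrite -ems.
move=> s1 s2 es; apply: msw_par => // t et a u v; rewrite -!catA /=.
apply: (lf s1 (s2 ++ t)); rewrite size_cat et smr ems -es.
by rewrite !(addSn, addnS) ?addnA.
Qed.

End MultiVariable.

Section Nested.
Variables (k : fieldType) (V : lmodType k) (C : coalgebra V).
(** For n > 0 these sums avoid the counit in which [iter_sw] ends, and reduce to the
    nested binary sums in which the identities are stated. *)
Fixpoint nest_sw (W : lmodType k) n (x : V) (f : seq V -> W) : W :=
  match n with
  | 0 => counit C x *: f [::]
  | 1 => f [:: x]
  | n'.+1 => \sw_(x1, x2 <- comul C x) nest_sw n' x2 (fun s => f (x1 :: s))
  end.
Fixpoint nest_msw (W : lmodType k) xs ns (f : seq V -> W) : W :=
  match xs, ns with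
  | x :: xs', n :: ns' => nest_sw n x (fun s => nest_msw xs' ns' (fun t => f (s ++ t)))
  | _, _ => f [::]
  end.

Lemma nest_swE (W : lmodType k) n x (f : seq V -> W) :
  multilinear n f -> iter_sw C n x f = nest_sw n x f.
Proof.
elim: n x f => // -[|n] IH x f lf; first by rewrite iter_sw1.
by apply: eq_sw => u v; apply: (IH _ (fun s => f (u :: s))); apply: multilinear_cons lf.
Qed.

Lemma eq_nest_sw (W : lmodType k) n x (f g : seq V -> W) :
  (forall s, size s = n -> f s = g s) -> nest_sw n x f = nest_sw n x g.
Proof.
elim: n x f g => [|[|n] IH] x f g fg; [by rewrite /= fg|exact: fg|].
apply: eq_sw => u v; apply: (IH v (fun s => f (u :: s)) (fun s => g (u :: s))) => s es.
by apply: fg; rewrite /= es.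
Qed.

Lemma nest_mswE (W : lmodType k) xs ns (f : seq V -> W) :
  size xs = size ns -> multilinear (sumn ns) f -> msw C xs ns f = nest_msw xs ns f.
Proof.
elim: xs ns f => [|x xs IH] [|n ns] f //= [e] lf.
rewrite nest_swE.
  by apply: eq_nest_sw => s es; apply: IH => //; exact: multilinear_catr lf es.
move=> s1 s2 es; apply: msw_par => // t et a u v; rewrite -!catA /=.
by apply: (lf s1 (s2 ++ t)); rewrite size_cat et -es !(addSn, addnS) addnA.
Qed.

End Nested.

(** * Comultiplying the values of coalgebra maps *)

Section LinearMore.
Variable k : fieldType.
Lemma lin_app (U V W : lmodType k) (F : {linear V -> W}) (G : U -> V) :
  linear G -> linear (fun x => F (G x)).
Proof. by move=> lG a x y; rewrite lG linearP. Qed.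
Lemma scal_app (U V : lmodType k) (F : {scalar V}) (G : U -> V) :
  linear G -> scalar (fun x => F (G x)).
Proof. by move=> lG a x y; rewrite lG linearP. Qed.
Lemma lin_mull (H : algType k) (U : lmodType k) (F : U -> H) b :
  linear F -> linear (fun x => F x * b).
Proof. by move=> lF a x y; rewrite lF mulrDl scalerAl. Qed.
Lemma lin_mulr (H : algType k) (U : lmodType k) (F : U -> H) b :
  linear F -> linear (fun x => b * F x).
Proof. by move=> lF a x y; rewrite lF mulrDr scalerAr. Qed.
End LinearMore.

Ltac lin_tac :=
  by repeat first [ assumption | exact: lin_id | exact: lin_can | exact: scal_can
    | apply: lin_sw => ? ? | apply: lin_tensl | apply: lin_tensr
    | apply: lin_scale | apply: lin_scaler | apply: lin_mull | apply: lin_mulr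
    | apply: lin_app | apply: scal_app
    | apply: lin_swr; [split=> ? |] | apply: tensor_lift_linear; split=> ? ].
Ltac bil_tac := split=> ?; lin_tac.

Definition zipw (T : Type) (op : T -> T -> T) s t := [seq op p.1 p.2 | p <- zip s t].

Section OpExpansion.
Variables (k : fieldType) (V : lmodType k).
Implicit Types (C : coalgebra V) (W : lmodType k).

Lemma zipw_cat (op : V -> V -> V) s1 s2 t1 t2 : size s1 = size t1 ->
  zipw op (s1 ++ s2) (t1 ++ t2) = zipw op s1 t1 ++ zipw op s2 t2.
Proof. by move=> e; rewrite /zipw zip_cat // map_cat. Qed.

Lemma size_zipw (op : V -> V -> V) s t : size s = size t -> size (zipw op s t) = size s.
Proof. by move=> e; rewrite size_map size_zip e minnn. Qed.

Lemma multilinear_zipl W n (op : V -> V -> V) (f : seq V -> W) t :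
  (forall v, linear (op^~ v)) -> multilinear n f -> size t = n ->
  multilinear n (fun s => f (zipw op s t)).
Proof.
move=> lop lf et s1 s2 e.
have et1 : size (take (size s1) t) = size s1 by rewrite size_takel // et -e leq_addr.
case et2: (drop (size s1) t) (size_drop (size s1) t) => [|v t2].
  by rewrite et -e addKn.
rewrite /= et -e addKn => -[e2] a x y.
rewrite -(cat_take_drop (size s1) t) et2 !zipw_cat //.
rewrite /zipw /= -!/(zipw op _ _) lop; apply: lf.
by rewrite !size_zipw // -e.
Qed.

Lemma multilinear_zipr W n (op : V -> V -> V) (f : seq V -> W) s :
  (forall u, linear (op u)) -> multilinear n f -> size s = n ->
  multilinear n (fun t => f (zipw op s t)).
Proof.
move=> lop lf es t1 t2 e.
have es1 : size (take (size t1) s) = size t1 by rewrite size_takel // es -e leq_addr.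
case es2: (drop (size t1) s) (size_drop (size t1) s) => [|u s2].
  by rewrite es -e addKn.
rewrite /= es -e addKn => -[e2] a x y.
rewrite -(cat_take_drop (size t1) s) es2 !zipw_cat //.
rewrite /zipw /= -!/(zipw op _ _) lop; apply: lf.
by rewrite !size_zipw // es1 e2.
Qed.

Lemma multilinear_map W n (F : V -> V) (f : seq V -> W) :
  linear F -> multilinear n f -> multilinear n (fun s => f (map F s)).
Proof.
by move=> lF lf s1 s2 e a x y; rewrite !map_cat /= lF; apply: lf; rewrite !size_map.
Qed.

Lemma iter_sw_cons_bilin C W n (f : seq V -> W) : multilinear n.+1 f ->
  bilin (fun x1 x2 => iter_sw C n x2 (fun s => f (x1 :: s))).
Proof.
move=> lf; split=> [v|u]; first by apply: iter_sw_par => s; apply: multilinear_head.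
exact/iter_sw_bilin/multilinear_cons.
Qed.

(** A bilinear coalgebra map carries iterated comultiplications to iterated
    comultiplications.  The case [CB = cop C] is that of a q-magma coalgebra. *)
Lemma iter_sw_op C CA CB W (op : V -> V -> V) n a b (f : seq V -> W) :
  (forall v, linear (op^~ v)) -> (forall u, linear (op u)) ->
  (forall u v, counit C (op u v) = counit CA u * counit CB v) ->
  (forall u v, comul C (op u v) = \sw_(u1, u2 <- comul CA u)
    \sw_(v1, v2 <- comul CB v) (op u1 v1 \ox op u2 v2)) ->
  multilinear n f ->
  iter_sw C n (op a b) f =
  iter_sw CA n a (fun s => iter_sw CB n b (fun t => f (zipw op s t))).
Proof.
move=> lopl lopr opE opD; elim: n a b f => [|n IH] a b f lf /=.
  by rewrite opE scalerA.
have bl := iter_sw_cons_bilin C lf; rewrite opD.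
rewrite (sw_lin _ _ (tensor_lift_linear bl)); apply: eq_sw => a1 a2.
rewrite (sw_lin _ _ (tensor_lift_linear bl)) -sw_iter_sw; apply: eq_sw => b1 b2.
rewrite tensor_liftE // (IH _ _ (fun s => f (op a1 b1 :: s))) //.
exact: multilinear_cons lf.
Qed.

Lemma iter_sw_cop C W n x (f : seq V -> W) : multilinear n f ->
  iter_sw (cop C) n x f = iter_sw C n x (fun s => f (rev s)).
Proof.
elim: n x f => [|n IH] x f lf //.
rewrite -[in RHS]addn1 [RHS]iter_sw_cat; last by rewrite addn1; apply: multilinear_rev lf.
rewrite [LHS]/= -/(cop_comul C) cop_sw; last exact: iter_sw_cons_bilin.
apply: eq_sw => u v; rewrite (IH _ (fun s => f (v :: s))); last exact: multilinear_cons lf.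
apply: eq_iter_sw => s es; rewrite iter_sw1 ?rev_cat //.
move=> [|? [|? ?]] [|? ?] //= _ a y z.
by rewrite !rev_cat; apply: (lf [::]); rewrite /= size_rev es.
Qed.

Lemma iter_sw_unop C CA W (F : V -> V) n a (f : seq V -> W) :
  linear F -> (forall u, counit C (F u) = counit CA u) ->
  (forall u, comul C (F u) = \sw_(u1, u2 <- comul CA u) (F u1 \ox F u2)) ->
  multilinear n f ->
  iter_sw C n (F a) f = iter_sw CA n a (fun s => f (map F s)).
Proof.
move=> lF FE FD; elim: n a f => [|n IH] a f lf /=; first by rewrite FE.
have bl := iter_sw_cons_bilin C lf; rewrite FD.
rewrite (sw_lin _ _ (tensor_lift_linear bl)); apply: eq_sw => a1 a2.
rewrite tensor_liftE // (IH _ (fun s => f (F a1 :: s))) //.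
exact: multilinear_cons lf.
Qed.

Lemma iter_sw_grouplike C W n x (f : seq V -> W) :
  counit C x = 1 -> comul C x = x \ox x -> multilinear n f ->
  iter_sw C n x f = f (nseq n x).
Proof.
move=> xE xD; elim: n f => [|n IH] f lf /=; first by rewrite xE scale1r.
rewrite xD tensor_liftE; last exact: iter_sw_cons_bilin.
by rewrite (IH (fun s => f (x :: s))) //; apply: multilinear_cons lf.
Qed.

End OpExpansion.

(** * The antipode *)

(** Inverses in a convolution algebra are unique: [f = f * (g * h) = (f * g) * h = h]. *)
Lemma convolution_inverse_unique (k : fieldType) (V W : lmodType k)
    (C : coalgebra V) (mul : W -> W -> W) (e : W) (f g h : V -> W) :
  bilin mul -> associative mul -> left_id e mul -> right_id e mul ->
  linear f -> linear g -> linear h ->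
  (forall x, \sw_(x1, x2 <- comul C x) mul (f x1) (g x2) = counit C x *: e) ->
  (forall x, \sw_(x1, x2 <- comul C x) mul (g x1) (h x2) = counit C x *: e) ->
  f =1 h.
Proof.
move=> [lml lmr] mulA mul1 mulr1 lf lg lh fg gh x.
transitivity (\sw_(x1, x2 <- comul C x) mul (f x1) (counit C x2 *: e)).
  rewrite -{1}(comul1r C x) (sw_lin _ _ lf); apply: eq_sw => u v.
  by rewrite (linZ _ _ (lmr _)) mulr1 linZ.
transitivity (\sw_(x1, x2 <- comul C x) \sw_(y1, y2 <- comul C x2)
    mul (mul (f x1) (g y1)) (h y2)).
  apply: eq_sw => u v; rewrite -gh (sw_lin _ _ (lmr _)).
  by apply: eq_sw => a b; rewrite mulA.
rewrite -(@comulA_sw _ _ _ C (fun u v w => mul (mul (f u) (g v)) (h w))).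
- transitivity (\sw_(x1, x2 <- comul C x) mul (counit C x1 *: e) (h x2)).
    by apply: eq_sw => u v; rewrite -fg (sw_lin _ _ (lml _)).
  rewrite -{2}(comul1l C x) (sw_lin _ _ lh); apply: eq_sw => u v.
  by rewrite (linZ _ _ (lml _)) mul1 linZ.
- by move=> u v; exact: lin_comp (lmr _) lh.
- by move=> u w; exact: lin_comp (lml _) (lin_comp (lmr _) lg).
- by move=> u w; exact: lin_comp (lml _) (lin_comp (lml _) lf).
Qed.

Section Antipode.
Variables (k : fieldType) (H : algType k) (HH : hopf_algebra H).
Local Notation Delta := (comul HH).
Local Notation eps := (counit HH).
Local Notation S := (antipode HH).

Lemma antipode1 : S 1 = 1.
Proof.
have := antipodel HH 1; rewrite comul_one tensor_liftE; last by bil_tac.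
by rewrite mulr1 counit_one scale1r.
Qed.

Lemma counit_antipode x : eps (S x) = eps x.
Proof.
have leS : linear (fun y => eps (S y) : k^o) by move=> a y z; rewrite !linearP.
have le : linear (eps : H -> k^o) by exact: scal_can.
transitivity (\sw_(x1, x2 <- Delta x) (eps (S x1) * eps x2 : k^o)).
  rewrite -[in LHS](comul1r HH x) (sw_lin _ (Delta x) leS).
  apply: (@eq_sw _ _ _ k^o) => u v; rewrite linearZ [LHS]linearZ /= mulrC //.
transitivity (eps (\sw_(x1, x2 <- Delta x) S x1 * x2)).
  rewrite (sw_lin _ (Delta x) le).
  by apply: (@eq_sw _ _ _ k^o) => u v; rewrite counitM.
by rewrite antipodel linearZ /= counit_one mulr1.
Qed.

(** Both sides are convolution inverses of the product [H \ot H -> H]. *)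
Lemma antipodeM x y : S (x * y) = S y * S x.
Proof.
pose D := tensor_coalgebra HH HH.
pose m (t : H \ot H) := \sw_(u, v <- t) u * v.
pose h (t : H \ot H) := \sw_(u, v <- t) S v * S u.
have lm : linear m by rewrite /m; lin_tac.
have lh : linear h by rewrite /h; lin_tac.
have mE u v : m (u \ox v) = u * v by apply: tensor_liftE; bil_tac.
have hE u v : h (u \ox v) = S v * S u by apply: tensor_liftE; bil_tac.
have lSm : linear (fun t => S (m t)) by lin_tac.
have bmul : bilin (fun a b : H => a * b) by bil_tac.
have lD (F G : H \ot H -> H) : linear F -> linear G ->
    linear (fun t => \sw_(x1, x2 <- comul D t) F x1 * G x2).
  move=> lF lG; apply: lin_swr; last exact: lin_can.
  by bil_tac.
have le : linear (fun t => counit D t *: (1 : H)).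
  by apply: lin_scale; apply: scal_can.
rewrite -mE -hE.
apply: (convolution_inverse_unique (C := D) (f := fun t => S (m t)) (g := m) (h := h)
  bmul (@mulrA _) (@mul1r _) (@mulr1 _)) => //; apply: tensor_eq_lin => [|//|u v]; try exact: lD.
- rewrite tensor_sw; last by bil_tac.
  transitivity (\sw_(x1, x2 <- Delta (u * v)) S x1 * x2); last first.
    by rewrite antipodel /D /= tensor_counitE counitM.
  have b : bilin (fun x1 x2 => S x1 * x2) by bil_tac.
  rewrite comulM (sw_lin _ _ (tensor_lift_linear b)); apply: eq_sw => u1 u2.
  rewrite (sw_lin _ _ (tensor_lift_linear b)); apply: eq_sw => v1 v2.
  by rewrite tensor_liftE // !mE.
- rewrite tensor_sw; last by bil_tac.
  transitivity (\sw_(u1, u2 <- Delta u) (u1 * (eps v)%:A) * S u2).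
    apply: eq_sw => u1 u2; rewrite -antipoder.
    rewrite (sw_lin (F := fun w => (u1 * w) * S u2)); last by lin_tac.
    by apply: eq_sw => v1 v2; rewrite mE hE !mulrA.
  rewrite /D /= tensor_counitE.
  transitivity (eps v *: \sw_(u1, u2 <- Delta u) u1 * S u2).
    rewrite (sw_lin (F := fun w => eps v *: w)); last by lin_tac.
    by apply: eq_sw => u1 u2; rewrite -scalerAr mulr1 scalerAl.
  by rewrite antipoder scalerA mulrC.
Qed.

(** The product of the algebra [H \ot H]. *)
Definition tmul (s t : H \ot H) : H \ot H :=
  \sw_(a, b <- s) \sw_(c, d <- t) ((a * c) \ox (b * d)).

Lemma tmul_bilin : bilin tmul.
Proof. by split=> [t|s]; rewrite /tmul; [apply: tensor_lift_linear; bil_tac|lin_tac]. Qed.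
Lemma tmulE a b c d : tmul (a \ox b) (c \ox d) = (a * c) \ox (b * d).
Proof. by rewrite /tmul tensor_liftE; [apply: tensor_liftE|]; bil_tac. Qed.

Lemma tmulA : associative tmul.
Proof.
have [ll lr] := tmul_bilin.
move=> r s t; move: t; apply: tensor_eq_lin => [||c1 c2].
- exact: lin_comp (lr _) (lr _).
- exact: lr.
move: s; apply: tensor_eq_lin => [||b1 b2].
- exact: lin_comp (lr _) (ll _).
- exact: lin_comp (ll _) (lr _).
move: r; apply: tensor_eq_lin => [||a1 a2].
- exact: ll.
- exact: lin_comp (ll _) (ll _).
by rewrite !tmulE !mulrA.
Qed.

Lemma tmul1 : left_id (1 \ox 1) tmul.
Proof.
apply: tensor_eq_lin => [||a b]; [exact: tmul_bilin.2|exact: lin_id|].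
by rewrite tmulE !mul1r.
Qed.
Lemma tmulr1 : right_id (1 \ox 1) tmul.
Proof.
apply: tensor_eq_lin => [||a b]; [exact: tmul_bilin.1|exact: lin_id|].
by rewrite tmulE !mulr1.
Qed.

(** Both sides are convolution inverses of [Delta] among the maps from [H] to the
    algebra [H \ot H]. *)
Lemma antipodeD x : Delta (S x) = \sw_(x1, x2 <- cop_comul HH x) (S x1 \ox S x2).
Proof.
rewrite cop_sw; last by bil_tac.
have [ll lr] := tmul_bilin.
pose h x := \sw_(x1, x2 <- Delta x) (S x2 \ox S x1).
apply: (convolution_inverse_unique (C := HH) (g := Delta) tmul_bilin tmulA tmul1 tmulr1
  (f := fun x => Delta (S x)) (h := h)).
- by lin_tac.
- exact: lin_can.
- by rewrite /h; lin_tac.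
- move=> {}x; transitivity (Delta (\sw_(x1, x2 <- Delta x) S x1 * x2)).
    rewrite (sw_lin _ _ (lin_can _)); apply: eq_sw => u v; by rewrite comulM.
  by rewrite antipodel linearZ /= comul_one.
move=> {}x.
transitivity (\sw_(a, b <- Delta x) \sw_(a1, a2 <- Delta a) \sw_(b1, b2 <- Delta b)
    ((a1 * S b2) \ox (a2 * S b1))).
  apply: eq_sw => a b; rewrite /tmul; apply: eq_sw => a1 a2.
  rewrite /h (sw_lin (F := fun t => \sw_(c, d <- t) ((a1 * c) \ox (a2 * d))));
    last by lin_tac.
  by apply: eq_sw => b1 b2; apply: tensor_liftE; bil_tac.
rewrite (@comulA_sw _ _ _ HH (fun a1 a2 b => \sw_(b1, b2 <- Delta b)
  ((a1 * S b2) \ox (a2 * S b1)))); try by move=> *; lin_tac.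
transitivity (\sw_(a, b <- Delta x) (a * S b) \ox (1 : H)); last first.
  by rewrite -(sw_lin (F := fun y => y \ox 1)) ?antipoder ?tensZl //; lin_tac.
apply: eq_sw => a b.
rewrite -(@comulA_sw _ _ _ HH (fun y1 b1 b2 => (a * S b2) \ox (y1 * S b1)));
  try by move=> *; lin_tac.
transitivity (\sw_(y1, y2 <- Delta b) (a * S (eps y1 *: y2)) \ox (1 : H)).
  apply: eq_sw => y1 y2; rewrite -(sw_lin (F := fun y => (a * S y2) \ox y));
    last by lin_tac.
  by rewrite antipoder tensZr linearZ /= -scalerAr tensZl.
by rewrite -(sw_lin (F := fun y => (a * S y) \ox 1)) ?comul1l //; lin_tac.
Qed.

End Antipode.

(** * The comultiplicativity of a q-magma coalgebra *)

Section QMagma.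
Variables (k : fieldType) (H : lmodType k) (C : coalgebra H).
Variables (dot colon : {linear (H \ot H)%type -> H}).
Hypothesis qmagma : q_magma_coalgebra C dot colon.
Local Notation "x \d y" := (dot (x \ox y)) (at level 40, left associativity).
Local Notation "x \c y" := (colon (x \ox y)) (at level 40, left associativity).
Local Notation Delta := (comul C).
Local Notation eps := (counit C).
Local Notation F := (q_magma_map C dot colon).

Lemma counit_dot x y : eps (x \d y) = eps x * eps y.
Proof. by case: qmagma. Qed.
Lemma counit_colon x y : eps (x \c y) = eps x * eps y.
Proof. by case: qmagma. Qed.

(** The projections of [H^cop \ot H] to its factors.  They are coalgebra maps, so
    composing them with [F] transfers comultiplicativity to [colon] and [dot]. *)
Definition pr1 (t : H \ot H) : H := \sw_(a, b <- t) eps b *: a.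
Definition pr2 (t : H \ot H) : H := \sw_(a, b <- t) eps a *: b.

Lemma pr1_linear : linear pr1. Proof. by rewrite /pr1; lin_tac. Qed.
Lemma pr2_linear : linear pr2. Proof. by rewrite /pr2; lin_tac. Qed.
Lemma pr1E a b : pr1 (a \ox b) = eps b *: a.
Proof. by apply: tensor_liftE; bil_tac. Qed.
Lemma pr2E a b : pr2 (a \ox b) = eps a *: b.
Proof. by apply: tensor_liftE; bil_tac. Qed.

Lemma q_magma_mapE x y : F (x \ox y) =
  \sw_(x1, x2 <- Delta x) \sw_(y1, y2 <- Delta y) ((y1 \c x2) \ox (x1 \d y2)).
Proof. by apply: tensor_liftE; bil_tac. Qed.

Lemma pr1_q_magma x y : pr1 (F (x \ox y)) = y \c x.
Proof.
rewrite q_magma_mapE (sw_lin _ _ pr1_linear).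
transitivity (\sw_(x1, x2 <- Delta x) (y \c (eps x1 *: x2))).
  apply: eq_sw => x1 x2; rewrite (sw_lin _ _ pr1_linear).
  rewrite -[in RHS](comul1r C y) (sw_lin (F := fun w => w \c (eps x1 *: x2)));
    last by lin_tac.
  by apply: eq_sw => y1 y2; rewrite pr1E counit_dot tensZl tensZr scalerA linearZ /= mulrC.
by rewrite -(sw_lin (F := fun w => y \c w)) ?comul1l //; lin_tac.
Qed.

Lemma pr2_q_magma x y : pr2 (F (x \ox y)) = x \d y.
Proof.
rewrite q_magma_mapE (sw_lin _ _ pr2_linear).
transitivity (\sw_(x1, x2 <- Delta x) ((eps x2 *: x1) \d y)).
  apply: eq_sw => x1 x2; rewrite (sw_lin _ _ pr2_linear).
  rewrite -[in RHS](comul1l C y) (sw_lin (F := fun w => (eps x2 *: x1) \d w));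
    last by lin_tac.
  by apply: eq_sw => y1 y2; rewrite pr2E counit_colon tensZl tensZr scalerA linearZ /= mulrC.
by rewrite -(sw_lin (F := fun w => w \d y)) ?comul1r //; lin_tac.
Qed.

Lemma tensor_map_tens (p q : H \ot H -> H) u v : linear p -> linear q ->
  tensor_map p q (u \ox v) = p u \ox q v.
Proof. by move=> lp lq; apply: tensor_liftE; bil_tac. Qed.

Lemma tensor_map_lin (p q : H \ot H -> H) : linear p -> linear q ->
  linear (tensor_map p q).
Proof. by move=> lp lq; rewrite /tensor_map; lin_tac. Qed.

(** The comultiplicativity of [F], tested by two linear maps.  The choices
    (pr2, pr2), (pr1, pr1) and (pr1, pr2) give [comul_dot], [comul_colon] and
    [q_magma_exchange]. *)
Lemma q_magma_split (p q : H \ot H -> H) x y : linear p -> linear q ->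
  tensor_map p q (tensor_comul (cop C) C (F (x \ox y))) =
  \sw_(x1, x2 <- Delta x) \sw_(y1, y2 <- cop_comul C y)
     (p (F (x1 \ox y1)) \ox q (F (x2 \ox y2))).
Proof.
move=> lp lq; have [_ _ [lF FD _]] := qmagma.
have lpq := tensor_map_lin lp lq.
have {FD} /= -> := FD (x \ox y).
rewrite /(tensor_map F F) tensor_sw; last by bil_tac.
rewrite (sw_lin _ _ lpq); apply: eq_sw => x1 x2.
rewrite (sw_lin _ _ lpq); apply: eq_sw => y1 y2.
exact: tensor_map_tens.
Qed.

Lemma tensor_split (p q : H \ot H -> H) a b : linear p -> linear q ->
  tensor_map p q (tensor_comul (cop C) C (a \ox b)) =
  \sw_(a1, a2 <- Delta a) \sw_(b1, b2 <- Delta b) (p (a2 \ox b1) \ox q (a1 \ox b2)).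
Proof.
move=> lp lq; have lpq := tensor_map_lin lp lq.
rewrite tensor_comulE cop_sw; last by bil_tac.
rewrite (sw_lin _ _ lpq); apply: eq_sw => x1 x2.
rewrite (sw_lin _ _ lpq); apply: eq_sw => y1 y2.
exact: tensor_map_tens.
Qed.

Lemma comul_dot x y : Delta (x \d y) =
  \sw_(x1, x2 <- Delta x) \sw_(y1, y2 <- comul (cop C) y) ((x1 \d y1) \ox (x2 \d y2)).
Proof.
have := @q_magma_split pr2 pr2 x y pr2_linear pr2_linear.
rewrite -pr2_q_magma => /esym e.
transitivity (tensor_map pr2 pr2 (tensor_comul (cop C) C (F (x \ox y)))); last first.
  by rewrite -e; apply: eq_sw => ? ?; apply: eq_sw => ? ?; rewrite !pr2_q_magma.
move: (F _); apply: tensor_eq_lin => [||a b].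
- by apply: lin_app; exact: pr2_linear.
- exact: lin_comp (tensor_map_lin pr2_linear pr2_linear) (tensor_comul_linear _ _).
rewrite tensor_split ?pr2E; [|exact: pr2_linear..].
transitivity (\sw_(a1, a2 <- Delta a) (eps (eps a2 *: a1) *: Delta b)).
  rewrite -(sw_lin (F := fun w => eps w *: Delta b)) ?comul1r ?linearZ //.
  by lin_tac.
apply: eq_sw => a1 a2.
transitivity (\sw_(b1, b2 <- Delta b) (eps (eps a2 *: a1) *: (b1 \ox b2))).
  rewrite -(sw_lin (F := fun w => eps (eps a2 *: a1) *: w)); last by lin_tac.
  by congr (_ *: _); rewrite /tensor_lift -tensor_sumE.
by apply: eq_sw => b1 b2; rewrite !pr2E tensZl tensZr scalerA linearZ.
Qed.

Lemma comul_colon x y : Delta (x \c y) =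
  \sw_(x1, x2 <- Delta x) \sw_(y1, y2 <- comul (cop C) y) ((x1 \c y1) \ox (x2 \c y2)).
Proof.
have lsw := @tensor_swap_linear k H H.
have := @q_magma_split pr1 pr1 y x pr1_linear pr1_linear.
rewrite -pr1_q_magma => /esym e.
transitivity (tensor_swap (tensor_map pr1 pr1 (tensor_comul (cop C) C (F (y \ox x))))); last first.
  transitivity (\sw_(y1, y2 <- Delta y) \sw_(x1, x2 <- Delta x) ((x1 \c y2) \ox (x2 \c y1))).
    rewrite -e (sw_lin _ _ lsw); apply: eq_sw => y1 y2; rewrite (sw_lin _ _ lsw).
    rewrite -[RHS](cop_sw C (f := fun x2 x1 => (x1 \c y2) \ox (x2 \c y1))); last by bil_tac.
    by apply: eq_sw => x1 x2; rewrite tensor_swapE !pr1_q_magma.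
  by rewrite exchange_sw; apply: eq_sw => x1 x2; rewrite cop_sw //; bil_tac.
move: (F _); apply: tensor_eq_lin => [||a b].
- by apply: lin_app; exact: pr1_linear.
- apply: lin_comp lsw _.
  exact: lin_comp (tensor_map_lin pr1_linear pr1_linear) (tensor_comul_linear _ _).
rewrite tensor_split ?pr1E; [|exact: pr1_linear..].
rewrite linearZ /= (sw_lin _ _ lsw).
transitivity (\sw_(a1, a2 <- Delta a) eps b *: (a1 \ox a2)).
  rewrite -(sw_lin (F := fun w => eps b *: w)); last by lin_tac.
  by congr (_ *: _); rewrite /tensor_lift -tensor_sumE.
apply: eq_sw => a1 a2; rewrite (sw_lin _ _ lsw).
transitivity (eps (\sw_(b1, b2 <- Delta b) eps b1 *: b2) *: (a1 \ox a2)).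
  by rewrite comul1l.
rewrite (sw_lin (F := fun w => eps w *: (a1 \ox a2))); last by lin_tac.
apply: eq_sw => b1 b2; rewrite !pr1E tensor_swapE tensZl tensZr scalerA linearZ /=.
by rewrite mulrC.
Qed.

Lemma q_magma_exchange x y :
  \sw_(x1, x2 <- Delta x) \sw_(y1, y2 <- Delta y) ((x1 \d y2) \ox (y1 \c x2)) =
  \sw_(x1, x2 <- Delta x) \sw_(y1, y2 <- Delta y) ((x2 \d y1) \ox (y2 \c x1)).
Proof.
have lsw := @tensor_swap_linear k H H.
have e : tensor_map pr1 pr2 (tensor_comul (cop C) C (F (x \ox y))) = F (x \ox y).
  move: (F _); apply: tensor_eq_lin => [||a b]; last 1 first.
  - rewrite tensor_split; [|exact: pr1_linear|exact: pr2_linear].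
    rewrite -[in RHS](comul1l C a) -[in RHS](comul1l C b).
    rewrite (sw_lin (F := fun w => w \ox _)); last by lin_tac.
    apply: eq_sw => a1 a2; rewrite (sw_lin (F := fun w => _ \ox w)); last by lin_tac.
    apply: eq_sw => b1 b2.
    by rewrite pr1E pr2E !tensZl !tensZr !scalerA mulrC.
  - exact: lin_comp (tensor_map_lin pr1_linear pr2_linear) (tensor_comul_linear _ _).
  - exact: lin_id.
move: e; rewrite q_magma_split; [|exact: pr1_linear|exact: pr2_linear].
rewrite q_magma_mapE => /(congr1 (@tensor_swap k H H)); rewrite !(sw_lin _ _ lsw) => e.
transitivity (\sw_(x1, x2 <- Delta x) tensor_swap
   (\sw_(y1, y2 <- Delta y) ((y1 \c x2) \ox (x1 \d y2)))).
  apply: eq_sw => x1 x2; rewrite (sw_lin _ _ lsw).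
  by apply: eq_sw => y1 y2; rewrite tensor_swapE.
rewrite -e; apply: eq_sw => x1 x2; rewrite (sw_lin _ _ lsw).
rewrite -[RHS](cop_sw C (f := fun y2 y1 => (x2 \d y1) \ox (y2 \c x1))); last by bil_tac.
by apply: eq_sw => y1 y2; rewrite tensor_swapE pr1_q_magma pr2_q_magma.
Qed.
End QMagma.

(** * Syntax of Sweedler expressions *)

Inductive binop := OMul | ODot | OCol.
(** A leaf is the position of a component in the list of the components of all
    variables. *)
Inductive tree := Leaf of nat | One | Anti of tree | Op of binop & tree & tree.

Definition binop_eqb (o o' : binop) :=
  match o, o' with
  | OMul, OMul | ODot, ODot | OCol, OCol => true
  | _, _ => false
  end.
Lemma binop_eqP : Equality.axiom binop_eqb.
Proof. by case=> [] []; constructor. Qed.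
HB.instance Definition _ := hasDecEq.Build binop binop_eqP.

Fixpoint tree_eqb t t' :=
  match t, t' with
  | Leaf l, Leaf l' => l == l'
  | One, One => true
  | Anti a, Anti a' => tree_eqb a a'
  | Op o a b, Op o' a' b' => [&& o == o', tree_eqb a a' & tree_eqb b b']
  | _, _ => false
  end.
Lemma tree_eqP : Equality.axiom tree_eqb.
Proof.
move=> t t'; apply: (iffP idP) => [|<-]; last first.
  by elim: {t'} t => //= o a -> b ->; rewrite eqxx.
elim: t t' => [l|| a IH|o a IHa b IHb] [l'||a'|o' a' b'] //=.
- by move/eqP->.
- by move/IH->.
- by case/and3P=> /eqP-> /IHa-> /IHb->.
Qed.
HB.instance Definition _ := hasDecEq.Build tree tree_eqP.

Fixpoint leaves t :=
  match t with
  | Leaf l => [:: l]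
  | One => [::]
  | Anti a => leaves a
  | Op _ a b => leaves a ++ leaves b
  end.
Definition leavesl ts := flatten (map leaves ts).

Lemma leavesl_Leaf s : leavesl (map Leaf s) = s.
Proof. by elim: s => //= l s IH; rewrite -[in RHS]IH. Qed.

(** [dot] and [colon] are coalgebra maps from [H \ot H^cop], hence reverse the
    components of their second argument; the product does not. *)
Definition twisted o := o != OMul.
Definition twist (T : Type) o (s : seq T) := if twisted o then rev s else s.

Lemma size_twist T o (s : seq T) : size (twist o s) = size s.
Proof. by rewrite /twist; case: twisted; rewrite ?size_rev. Qed.
Lemma map_twist T T' (f : T -> T') o s : map f (twist o s) = twist o (map f s).
Proof. by rewrite /twist; case: twisted; rewrite ?map_rev. Qed.

(** The [m] components of a term.  Each leaf, in order of occurrence, is replaced by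
    a block of [m] consecutive leaves, numbered from [b]; the antipode and the
    twisted operations read blocks backwards. *)
Fixpoint copies m b t : seq tree :=
  match t with
  | Leaf _ => map Leaf (iota b m)
  | One => nseq m One
  | Anti a => map Anti (rev (copies m b a))
  | Op o a c =>
    zipw (Op o) (copies m b a) (twist o (copies m (b + m * size (leaves a)) c))
  end.

Fixpoint copiesl b (ms : seq nat) ts : seq tree :=
  match ms, ts with
  | m :: ms', t :: ts' =>
      copies m b t ++ copiesl (b + m * size (leaves t)) ms' ts'
  | _, _ => [::]
  end.

Fixpoint mults (ms : seq nat) ts : seq nat :=
  match ms, ts with
  | m :: ms', t :: ts' => nseq (size (leaves t)) m ++ mults ms' ts'
  | _, _ => [::]
  end.

Fixpoint relabel (f : nat -> nat) t :=
  match t with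
  | Leaf l => Leaf (f l)
  | One => One
  | Anti a => Anti (relabel f a)
  | Op o a b => Op o (relabel f a) (relabel f b)
  end.

Fixpoint subst (f : nat -> tree) t :=
  match t with
  | Leaf l => f l
  | One => One
  | Anti a => Anti (subst f a)
  | Op o a b => Op o (subst f a) (subst f b)
  end.

(** The number of components of each variable, and the outputs.  An expression
    is well formed if its outputs use each component once: it is then multilinear,
    and a variable with no component contributes its counit. *)
Definition expr := (seq nat * seq tree)%type.
Definition wf (E : expr) := perm_eq (leavesl E.2) (iota 0 (sumn E.1)).

(** The composite feeds the outputs of [A] to the variables of [D].  Each leaf
    of [A] then has as many components as the variable of [D] that receives its
    output ([comp_mults]).  [copiesl] numbers these components in the order in
    which the leaves occur in [A], and [comp_perm] sends this numbering to the one
    in which variables and components are in order. *)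
Section Comp.
Variables D A : expr.
Definition comp_mults :=
  let ls := leavesl A.2 in
  [seq nth 0%N (mults D.1 A.2) (index j ls) | j <- iota 0 (sumn A.1)].
Definition comp_perm :=
  flatten [seq nth [::] (reshape comp_mults (iota 0 (sumn comp_mults))) j | j <- leavesl A.2].
Definition comp_args :=
  map (relabel (nth (sumn comp_mults) comp_perm)) (copiesl 0 D.1 A.2).
Definition comp_ns := [seq sumn r | r <- reshape A.1 comp_mults].
Definition comp : expr := (comp_ns, map (subst (nth One comp_args)) D.2).
Definition comp_ok :=
  [&& size A.2 == size D.1, wf A, wf D &
      perm_eq (leavesl comp_args) (iota 0 (sumn comp_mults))].
End Comp.

(** Variables that a rule leaves alone pass through [n] additional outputs. *)
Definition extend n (E : expr) : expr :=
  (E.1 ++ nseq n 1%N, E.2 ++ map Leaf (iota (sumn E.1) n)).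

(** An occurrence of the pattern [L]: its variables are bound to terms by [A], and
    [C] is the surrounding context. *)
Definition instance n (L C A : expr) := comp C (comp (extend n L) A).
Definition instance_ok n (L C A : expr) :=
  [&& wf L, comp_ok (extend n L) A & comp_ok C (comp (extend n L) A)].

(** * Searching for rewriting steps *)

(** The search is heuristic; its results are sound because [rewrites] recomputes
    the expression from each candidate and discards the candidates that do not give
    it back. *)
Fixpoint occs t : seq (tree * (tree -> tree)) :=
  (t, id) :: match t with
  | Anti a => [seq (p.1, Anti \o p.2) | p <- occs a]
  | Op o a b => [seq (p.1, (Op o)^~ b \o p.2) | p <- occs a] ++
                [seq (p.1, Op o a \o p.2) | p <- occs b]
  | _ => [::]
  end.
Fixpoint occsl ts : seq (tree * (tree -> seq tree)) :=
  if ts is t :: ts' then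
    [seq (p.1, cons^~ ts' \o p.2) | p <- occs t] ++
    [seq (p.1, cons t \o p.2) | p <- occsl ts']
  else [::].

Fixpoint tmatch p t (b : seq (nat * tree)) :=
  match p, t with
  | Leaf l, _ => Some ((l, t) :: b)
  | One, One => Some b
  | Anti p', Anti t' => tmatch p' t' b
  | Op o p1 p2, Op o' t1 t2 =>
      if binop_eqb o o' then
        if tmatch p1 t1 b is Some b' then tmatch p2 t2 b' else None
      else None
  | _, _ => None
  end.

Fixpoint search ps j ts b : seq (seq tree * seq (nat * tree)) :=
  if ps is p :: ps' then
    flatten [seq if tmatch p o.1 b is Some b' then search ps' j.+1 (o.2 (Leaf j)) b'
                 else [::] | o <- occsl ts]
  else [:: (ts, b)].

(** Recovers a term from its first and last components: a block of leaves starts at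
    the lesser of its two ends, in whichever direction it is read. *)
Fixpoint merge t t' :=
  match t, t' with
  | Leaf l, Leaf l' => Leaf (if (l <= l')%N then l else l')
  | Anti a, Anti a' => Anti (merge a a')
  | Op o a b, Op _ a' b' => Op o (merge a a') (merge b b')
  | _, _ => t
  end.

Definition lookup (b : seq (nat * tree)) l :=
  if [seq p.2 | p <- b & p.1 == l] is t :: _ then t else One.

(** The terms bound to the variables of a pattern; [One] stands for a variable that
    the pattern uses through its counit only. *)
Fixpoint merged off ns b :=
  if ns is n :: ns' then
    (if n is n'.+1 then merge (lookup b off) (lookup b (off + n')) else One)
      :: merged (off + n) ns' b
  else [::].

Definition candidate (L E : expr) (c : seq tree * seq (nat * tree)) : nat * expr * expr :=
  let N := sumn E.1 in
  let args := merged 0 L.1 c.2 in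
  let used := leavesl [seq p.2 | p <- c.2] in
  let pass := [seq l <- iota 0 N | l \notin used] in
  let labels := [seq l <- iota 0 N | l \in leavesl args ++ pass] in
  (size pass,
   (nseq (size L.2 + size pass) 1%N,
    map (relabel (fun l => if (N <= l)%N then l - N else size L.2 + index l pass)%N) c.1),
   ([seq count (mem labels) r | r <- reshape E.1 (iota 0 N)],
    map (relabel (index^~ labels)) (args ++ map Leaf pass))).

Definition rewrites (L R E : expr) : seq expr :=
  pmap (fun c => let: (n, C, A) := candidate L E c in
    if [&& E == instance n L C A, instance_ok n L C A & instance_ok n R C A]
    then Some (instance n R C A) else None)
  (search L.2 (sumn E.1) E.2 [::]).

Fixpoint normalize1 (rs : seq (expr * expr)) E : option expr :=
  if rs is r :: rs' then
    if rewrites r.1 r.2 E is E' :: _ then Some E' else normalize1 rs' E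
  else None.
Fixpoint normalize n rs E :=
  if n is n'.+1 then if normalize1 rs E is Some E' then normalize n' rs E' else E else E.

(* bounds the recursion; a longer simplification would merely be cut short *)
Definition fuel := 40%N.
Definition reaches rs L R E E' :=
  let F := normalize fuel rs E' in
  has (fun E'' => normalize fuel rs E'' == F) (rewrites L R E).

(** The component [i] of the variable [v].  Only the order of the labels matters to
    [expr_of]; the factor 16 keeps the components of different variables apart. *)
Definition slot v i := Leaf (16 * v + i).
Definition expr_of p ts : expr :=
  let ls := leavesl ts in
  ([seq count (fun l => (16 * v <= l < 16 * v.+1)%N) ls | v <- iota 0 p],
   map (relabel (fun l => count (fun l' => l' < l)%N ls)) ts).

(** * Soundness of the calculus *)

Section SweedlerCalculus.
Variables (k : fieldType) (H : algType k) (HH : hopf_algebra H).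
Variables (dot colon : {linear (H \ot H)%type -> H}).
Hypothesis qmagma : q_magma_coalgebra HH dot colon.
Local Notation isw := (iter_sw HH).
Local Notation msw := (msw HH).
Implicit Type W : lmodType k.

Definition opf o (x y : H) : H :=
  match o with OMul => x * y | ODot => dot (x \ox y) | OCol => colon (x \ox y) end.

Fixpoint eval (s : seq H) t : H :=
  match t with
  | Leaf l => nth 0 s l
  | One => 1
  | Anti a => antipode HH (eval s a)
  | Op o a b => opf o (eval s a) (eval s b)
  end.

Lemma opf_linl o y : linear (opf o ^~ y).
Proof. by case: o; rewrite /opf; lin_tac. Qed.
Lemma opf_linr o x : linear (opf o x).
Proof. by case: o; rewrite /opf; lin_tac. Qed.

Lemma iter_sw_opf W o n x y (f : seq H -> W) : multilinear n f ->
  isw n (opf o x y) f =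
  isw n x (fun s => isw n y (fun t => f (zipw (opf o) s (twist o t)))).
Proof.
move=> lf.
have -> : isw n (opf o x y) f = isw n x (fun s => iter_sw
   (if twisted o then cop HH else HH) n y (fun t => f (zipw (opf o) s t))).
  apply: iter_sw_op => // [v|u|u v|u v]; [exact: opf_linl|exact: opf_linr|..];
    by case: o => /=; rewrite (counitM, counit_dot qmagma, counit_colon qmagma, comulM,
               comul_dot qmagma, comul_colon qmagma).
apply: eq_iter_sw => s es; rewrite /twist; case: ifP => // _.
rewrite iter_sw_cop //; apply: multilinear_zipr => //; exact: opf_linr.
Qed.

Lemma iter_sw_antipode W n x (f : seq H -> W) : multilinear n f ->
  isw n (antipode HH x) f = isw n x (fun s => f (map (antipode HH) (rev s))).
Proof.
move=> lf; rewrite (@iter_sw_unop _ _ HH (cop HH)) //.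
- by rewrite iter_sw_cop //; apply: multilinear_map lf; exact: lin_can.
- exact: lin_can.
- exact: counit_antipode.
- exact: antipodeD.
Qed.

Lemma eval_eq s s' t : {in leaves t, forall l, nth 0 s l = nth 0 s' l} ->
  eval s t = eval s' t.
Proof.
elim: t => //= [l|a IH|o a IHa b IHb] e.
- by apply: e; rewrite inE.
- by rewrite IH.
- by rewrite IHa ?IHb // => l hl; apply: e; rewrite mem_cat hl ?orbT.
Qed.

Lemma multilinear_comp_twist W n o (f : seq H -> W) :
  multilinear n f -> multilinear n (fun s => f (twist o s)).
Proof. by rewrite /twist; case: twisted => //; apply: multilinear_rev. Qed.

Lemma size_copies m b t : size (copies m b t) = m.
Proof.
elim: t b => [l||a IH|o a IHa c IHc] b /=.
- by rewrite size_map size_iota.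
- by rewrite size_nseq.
- by rewrite size_map size_rev.
- by rewrite size_map size_zip size_twist IHa IHc minnn.
Qed.

Lemma leaves_zipw o (s t : seq tree) l : size s = size t ->
  l \in leavesl (zipw (Op o) s t) = (l \in leavesl s) || (l \in leavesl t).
Proof.
rewrite /leavesl /zipw; elim: s t => [|a s IH] [|c t] //= [e].
by rewrite !mem_cat IH // -!orbA; congr orb; rewrite orbCA.
Qed.

Lemma leavesl_twist o (s : seq tree) : leavesl (twist o s) =i leavesl s.
Proof.
rewrite /twist; case: twisted => // l; rewrite /leavesl map_rev.
elim: (map _ _) => //= a r IH.
by rewrite rev_cons -cats1 flatten_cat mem_cat IH /= cats0 mem_cat orbC.
Qed.

Lemma leaves_copies m b t l : l \in leavesl (copies m b t) ->
  (b <= l < b + m * size (leaves t))%N.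
Proof.
elim: t b => [i||a IH|o a IHa c IHc] b /=.
- by rewrite leavesl_Leaf muln1 mem_iota.
- by rewrite /leavesl map_nseq; elim: m.
- rewrite /leavesl -map_comp (@eq_map _ _ _ leaves) // => hl; apply: IH.
  by rewrite -(leavesl_twist ODot).
- rewrite leaves_zipw ?size_twist ?size_copies // leavesl_twist size_cat mulnDr.
  by case/orP=> [/IHa|/IHc]; lia.
Qed.

Lemma map_eval_zipw s o a c :
  map (eval s) (zipw (Op o) a c) = zipw (opf o) (map (eval s) a) (map (eval s) c).
Proof. by rewrite /zipw; elim: a c => [|x a IH] [|y c] //=; rewrite IH. Qed.

Lemma map_eval_copies_local m t pre s post post' :
  size s = (m * size (leaves t))%N ->
  map (eval (pre ++ s ++ post)) (copies m (size pre) t) =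
  map (eval (pre ++ s ++ post')) (copies m (size pre) t).
Proof.
move=> es; apply/eq_in_map => u hu; apply: eval_eq => l hl.
have /leaves_copies : l \in leavesl (copies m (size pre) t).
  by apply/flattenP; exists (leaves u) => //; apply: map_f.
move=> /andP[h1 h2]; rewrite !nth_cat es.
case: ltnP => // h3. have -> : (l - size pre < m * size (leaves t))%N by lia. by [].
Qed.

(** The lists [pre] and [post] surround the block of components that the term uses;
    keeping them arbitrary lets the two factors of a product share one list. *)
Lemma iter_sw_tree W m t s pre post (f : seq H -> W) : multilinear m f ->
  isw m (eval s t) f =
  msw (map (nth 0 s) (leaves t)) (nseq (size (leaves t)) m)
    (fun u => f (map (eval (pre ++ u ++ post)) (copies m (size pre) t))).
Proof.
elim: t pre post f => [l||a IH|o a IHa c IHc] pre post f lf /=.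
- apply: eq_iter_sw => u eu; rewrite cats0; congr f.
  apply: (@eq_from_nth _ 0); first by rewrite !size_map size_iota.
  move=> i hi; rewrite -map_comp (nth_map 0%N) ?size_iota -?eu //=.
  rewrite nth_iota -?eu // !nth_cat.
  by rewrite [(_ + i < _)%N]ltnNge leq_addr /= addKn hi.
- rewrite iter_sw_grouplike ?counit_one ?comul_one // map_nseq //.
- rewrite iter_sw_antipode //.
  rewrite (IH pre post); last first.
    apply: (@multilinear_rev _ _ _ _ (fun s => f (map (antipode HH) s))).
    by apply: multilinear_map lf; exact: lin_can.
  apply: eq_msw; first by rewrite size_map size_nseq.
  by move=> u eu; congr f; rewrite -!map_rev -!map_comp.
rewrite iter_sw_opf // (IHa pre post); last first.
  move=> s1 s2 e; apply: iter_sw_par => t et.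
  have := @multilinear_zipl _ _ _ m (opf o) f (twist o t) (opf_linl o) lf.
  by rewrite size_twist => /(_ et); apply.
rewrite size_cat nseqD map_cat msw_cat; last by rewrite size_map size_nseq.
apply: eq_msw; first by rewrite size_map size_nseq.
move=> u; rewrite sumn_nseq => eu.
rewrite (IHc (pre ++ u) post); last first.
  apply: (@multilinear_comp_twist _ _ o (fun w => f (zipw (opf o) _ w))).
  apply: multilinear_zipr => //; first exact: opf_linr.
  by rewrite size_map size_copies.
apply: eq_msw; first by rewrite size_map size_nseq.
move=> v _; congr f; rewrite map_eval_zipw map_twist size_cat eu -!catA.
by rewrite (@map_eval_copies_local m a pre u post (v ++ post)).
Qed.

Lemma size_copiesl b ms ts : size ms = size ts -> size (copiesl b ms ts) = sumn ms.
Proof.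
elim: ms ts b => [|m ms IH] [|t ts] b //= [e].
by rewrite size_cat size_copies IH.
Qed.

Lemma size_mults ms ts : size ms = size ts -> size (mults ms ts) = size (leavesl ts).
Proof.
elim: ms ts => [|m ms IH] [|t ts] //= [e].
by rewrite /leavesl /= !size_cat size_nseq IH.
Qed.

Lemma msw_trees W ms ts s pre post (f : seq H -> W) :
  size ms = size ts -> multilinear (sumn ms) f ->
  msw (map (eval s) ts) ms f =
  msw (map (nth 0 s) (leavesl ts)) (mults ms ts)
    (fun u => f (map (eval (pre ++ u ++ post)) (copiesl (size pre) ms ts))).
Proof.
elim: ts ms pre f => [|t ts IH] [|m ms] pre f //= [e] lf.
rewrite (iter_sw_tree t s pre [::]); last first.
  move=> s1 s2 es; apply: msw_par => [|u eu a x y]; first by rewrite size_map.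
  rewrite -!catA /=; apply: (lf s1 (s2 ++ u)).
  by rewrite size_cat eu -es !(addSn, addnS) addnA.
rewrite /leavesl /= -/(leavesl _) map_cat msw_cat ?size_map ?size_nseq //.
apply: eq_msw => [|u]; rewrite ?size_map ?size_nseq // sumn_nseq => eu.
rewrite (IH _ (pre ++ u)) //; last by apply: multilinear_catr lf _; rewrite size_map size_copies.
apply: eq_msw => [|v _]; first by rewrite size_map size_mults.
rewrite map_cat size_cat eu -!catA; congr (f (_ ++ _)).
by rewrite (@map_eval_copies_local m t pre u [::] (v ++ post)).
Qed.

Lemma eval_const s1 s2 x y t : size s1 \notin leaves t ->
  eval (s1 ++ x :: s2) t = eval (s1 ++ y :: s2) t.
Proof.
move=> h; apply: eval_eq => l hl; rewrite !nth_cat; case: ltnP => // hs.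
case e: (l - size s1)%N => [|i] //; case/negP: h.
by have -> : size s1 = l by apply/eqP; rewrite eqn_leq hs /= -subn_eq0 e.
Qed.

Lemma eval_linear s1 s2 t : count_mem (size s1) (leaves t) = 1%N ->
  linear (fun x => eval (s1 ++ x :: s2) t).
Proof.
elim: t => [l||a IH|o a IHa b IHb] //=.
- rewrite addn0; case: eqP => // -> _ c x y.
  by rewrite !nth_cat ltnn subnn.
- by move=> h; apply: lin_app; apply: IH.
rewrite count_cat => h.
have [ha|ha] := posnP (count_mem (size s1) (leaves a)).
- move=> c x y; rewrite !(@eval_const s1 s2 _ 0 a) ?IHb ?opf_linr //.
  + by rewrite -h ha.
  + by apply/count_memPn.
  + by apply/count_memPn.
  + by apply/count_memPn.
have one_of n m : (n + m)%N = 1%N -> (0 < n)%N -> n = 1%N /\ m = 0%N by lia.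
have [ha1 hb] := one_of _ _ h ha.
move=> c x y; rewrite !(@eval_const s1 s2 _ 0 b) ?IHa ?opf_linl //; exact/count_memPn.
Qed.

Lemma multilinear_trees W n ts (f : seq H -> W) :
  perm_eq (leavesl ts) (iota 0 n) -> multilinear (size ts) f ->
  multilinear n (fun s => f (map (eval s) ts)).
Proof.
move=> pts lf s1 s2 e.
have c1 : count_mem (size s1) (leavesl ts) = 1%N.
  rewrite (permP pts) count_uniq_mem ?iota_uniq // mem_iota add0n /= -e.
  by rewrite addnS ltnS leq_addr.
have : size s1 \in leavesl ts by rewrite -has_pred1 has_count c1.
case/flattenP => r /mapP[t ht ->] hl.
move: c1 lf; case/path.splitPr: ht => t1 t2.
rewrite /leavesl map_cat flatten_cat /= !count_cat -!/(leavesl _) => c1 lf.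
have ct : (0 < count_mem (size s1) (leaves t))%N by rewrite -has_count has_pred1.
have n0 ts' : count_mem (size s1) (leavesl ts') = 0%N -> forall x,
    map (eval (s1 ++ x :: s2)) ts' = map (eval (s1 ++ 0 :: s2)) ts'.
  move=> h x; apply/eq_in_map => u hu; apply: eval_const.
  apply: contraL hu => hu; apply/negP => hu'; move/count_memPn: h; case/negP.
  by apply/flattenP; exists (leaves u) => //; apply: map_f.
have one_of p q m : (p + (q + m))%N = 1%N -> (0 < q)%N ->
    [/\ p = 0, q = 1 & m = 0]%N by move=> ? ?; split; lia.
have [h1 ht1 h2] := one_of _ _ _ c1 ct.
move=> a x y; rewrite !map_cat /= !(n0 _ h1) !(n0 _ h2) (eval_linear _ ht1).
by apply: lf; rewrite !size_map size_cat.
Qed.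

(** The components of each variable are kept in a block of their own, which makes
    reordering the variables a reindexing of blocks. *)
Fixpoint block_sw W (ps : seq (H * nat)) (F : seq (seq H) -> W) : W :=
  if ps is p :: ps' then isw p.2 p.1 (fun s => block_sw ps' (fun ss => F (s :: ss)))
  else F [::].

Lemma eq_block_sw W ps (F G : seq (seq H) -> W) :
  (forall ss, shape ss = unzip2 ps -> F ss = G ss) -> block_sw ps F = block_sw ps G.
Proof.
elim: ps F G => [|p ps IH] F G FG /=; first exact: FG.
by apply: eq_iter_sw => s es; apply: IH => ss ess; apply: FG; rewrite /= es ess.
Qed.

Lemma msw_block_sw W xs ns (f : seq H -> W) : size xs = size ns ->
  msw xs ns f = block_sw (zip xs ns) (fun ss => f (flatten ss)).
Proof.
elim: xs ns f => [|x xs IH] [|n ns] f //= [e].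
by apply: eq_iter_sw => s _; rewrite IH.
Qed.

Lemma block_sw_cat W ps qs (F : seq (seq H) -> W) :
  block_sw (ps ++ qs) F = block_sw ps (fun a => block_sw qs (fun b => F (a ++ b))).
Proof. by elim: ps F => //= p ps IH F; apply: eq_iter_sw => s _; apply: IH. Qed.

Lemma iter_sw_block_sw W n x ps (F : seq H -> seq (seq H) -> W) :
  isw n x (fun s => block_sw ps (F s)) = block_sw ps (fun ss => isw n x (F^~ ss)).
Proof.
elim: ps F => //= p ps IH F.
by rewrite iter_sw_exch; apply: eq_iter_sw => s _; apply: IH.
Qed.

Lemma block_sw_exch W ps qs (F : seq (seq H) -> seq (seq H) -> W) :
  block_sw ps (fun a => block_sw qs (F a)) = block_sw qs (fun b => block_sw ps (F^~ b)).
Proof.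
elim: ps F => //= p ps IH F.
by rewrite -iter_sw_block_sw; apply: eq_iter_sw => s _; rewrite IH.
Qed.

(** Comultiplications of different variables commute. *)
Lemma block_sw_perm W (X : nat -> H * nat) (F : (nat -> seq H) -> W) ls ls' :
  uniq ls -> perm_eq ls ls' ->
  block_sw (map X ls) (fun ss => F (fun j => nth [::] ss (index j ls))) =
  block_sw (map X ls') (fun ss => F (fun j => nth [::] ss (index j ls'))).
Proof.
move=> uls pls.
pose P l := uniq l -> perm_eq ls l ->
  block_sw (map X l) (fun ss => F (fun j => nth [::] ss (index j l))) =
  block_sw (map X ls) (fun ss => F (fun j => nth [::] ss (index j ls))).
suff step s1 s2 s3 : P (s1 ++ s2 ++ s3) -> P (s2 ++ s1 ++ s3).
  by symmetry; apply: (catCA_perm_ind step pls) => //; rewrite -(perm_uniq pls).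
move=> IH us ps.
have pc : perm_eq (s2 ++ s1 ++ s3) (s1 ++ s2 ++ s3) by rewrite perm_catCA.
rewrite -IH; last first.
- exact: perm_trans ps pc.
- by rewrite -(perm_uniq pc).
rewrite !map_cat !block_sw_cat.
transitivity (block_sw (map X s2) (fun b => block_sw (map X s1) (fun a =>
   block_sw (map X s3) (fun c => F (fun j => nth [::] (b ++ a ++ c) (index j (s2 ++ s1 ++ s3))))))).
  by apply: eq_block_sw => b _; rewrite block_sw_cat.
rewrite block_sw_exch; apply: eq_block_sw => a ea; rewrite block_sw_cat.
apply: eq_block_sw => b eb; apply: eq_block_sw => c _; congr F; apply: boolp.funext => j.
have sa : size a = size s1 by rewrite -[LHS](size_map size) -/(shape a) ea !size_map.
have sb : size b = size s2 by rewrite -[LHS](size_map size) -/(shape b) eb !size_map.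
rewrite !index_cat.
move: us; rewrite !cat_uniq has_cat => /and3P[_ /norP[h21 _] _].
have [j1|j1] := boolP (j \in s1); have [j2|j2] := boolP (j \in s2).
- by case/hasP: h21; exists j.
- rewrite nth_cat sb ltnNge leq_addr /= addKn nth_cat sa index_mem j1.
  by rewrite nth_cat sa index_mem j1.
- rewrite nth_cat sb index_mem j2 nth_cat sa ltnNge leq_addr /= addKn.
  by rewrite nth_cat sb index_mem j2.
- rewrite nth_cat sb ltnNge leq_addr /= addKn nth_cat sa ltnNge leq_addr /= addKn.
  by rewrite nth_cat sa ltnNge leq_addr /= addKn nth_cat sb ltnNge leq_addr /= addKn.
Qed.

Lemma eval_relabel (u : seq H) p t :
  eval (map (nth 0 u) p) t = eval u (relabel (nth (size u) p) t).
Proof.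
elim: t => //= [l|a ->|o a -> b ->] //.
have [h|h] := ltnP l (size p); first by rewrite (nth_map (size u)).
by rewrite !nth_default ?size_map.
Qed.

Lemma msw_perm W s ls (M : seq nat) (f : seq H -> W) :
  perm_eq ls (iota 0 (size s)) -> size M = size ls ->
  let M' := [seq nth 0%N M (index j ls) | j <- iota 0 (size s)] in
  let p := flatten [seq nth [::] (reshape M' (iota 0 (sumn M'))) j | j <- ls] in
  msw (map (nth 0 s) ls) M f = msw s M' (fun u => f (map (nth 0 u) p)).
Proof.
move=> pls eM M' p.
have uls : uniq ls by rewrite (perm_uniq pls) iota_uniq.
pose X l := (nth 0 s l, nth 0%N M (index l ls)).
rewrite msw_block_sw ?size_map //.
have -> : zip (map (nth 0 s) ls) M = map X ls.
  apply: (@eq_from_nth _ (0, 0%N)); first by rewrite size_zip !size_map eM minnn.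
  move=> i; rewrite size_zip size_map eM minnn => hi.
  rewrite nth_zip ?size_map // (nth_map 0%N) // (nth_map 0%N) // /X.
  by rewrite index_uniq.
have flE (e : nat -> seq H) : map e ls = map e ls by [].
transitivity (block_sw (map X ls) (fun ss => f (flatten [seq nth [::] ss (index j ls) | j <- ls]))).
  apply: eq_block_sw => ss ess; congr (f (flatten _)).
  have sss : size ss = size ls by rewrite -[LHS](size_map size) -/(shape ss) ess !size_map.
  apply: (@eq_from_nth _ [::]); first by rewrite size_map.
  by move=> i; rewrite sss => hi; rewrite (nth_map 0%N) // index_uniq.
rewrite (block_sw_perm X (fun e => f (flatten (map e ls))) uls pls).
rewrite [RHS]msw_block_sw; last by rewrite size_map size_iota.
have -> : zip s M' = map X (iota 0 (size s)).
  apply: (@eq_from_nth _ (0, 0%N)); rewrite size_zip !size_map size_iota minnn //.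
  move=> i hi; rewrite nth_zip ?size_map ?size_iota //.
  by rewrite (nth_map 0%N) ?size_iota // (nth_map 0%N) ?size_iota // nth_iota.
apply: eq_block_sw => ss ess; congr f; rewrite /p map_flatten -map_comp.
have shM : shape ss = M'.
  by rewrite ess /unzip2 -map_comp; apply: eq_map.
congr flatten; apply/eq_in_map => j; rewrite (perm_mem pls) mem_iota => /andP[_ hj].
have -> : index j (iota 0 (size s)) = j.
  by rewrite -{1}[j]add0n -{1}(nth_iota 0 0 hj) index_uniq ?size_iota ?iota_uniq.
have mapK (v : seq H) : map (nth 0 v) (iota 0 (size v)) = v.
  by rewrite -[RHS](mkseq_nth 0).
have map_reshape sh l : map (map (nth 0 (flatten ss))) (reshape sh l) =
    reshape sh (map (nth 0 (flatten ss)) l).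
  by elim: sh l => //= n sh IH l; rewrite IH map_take map_drop.
have sj : (j < size (reshape M' (iota 0 (sumn M'))))%N.
  by rewrite size_reshape -shM size_map -(size_map size) -/(shape ss) ess !size_map size_iota.
rewrite /= -(nth_map _ [::] (map (nth 0 (flatten ss)))) // map_reshape -shM.
by rewrite -size_flatten mapK flattenK.
Qed.

(** The leaves of [A] are comultiplied where they occur, the variables reordered, and
    coassociativity merges the result with the comultiplications made by [A]. *)
Lemma msw_comp W D A xs (G : seq H -> W) :
  comp_ok D A -> size xs = size A.1 -> multilinear (sumn D.1) G ->
  msw xs A.1 (fun s => msw (map (eval s) A.2) D.1 G) =
  msw xs (comp D A).1 (fun u => G (map (eval u) (comp_args D A))).
Proof.
case/and4P=> /eqP sA wA wD wK exs lG.
have szm : size (mults D.1 A.2) = size (leavesl A.2) by rewrite size_mults.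
have scm : size (comp_mults D A) = sumn A.1 by rewrite size_map size_iota.
rewrite /= /comp_ns -msw_assoc //.
- apply: eq_msw => // s es.
  rewrite (msw_trees _ [::] [::]) //.
  rewrite msw_perm ?es //; apply: eq_msw; first by rewrite scm.
  move=> u eu; congr G; rewrite /comp_args -!map_comp; apply/eq_in_map => t _ /=.
  by rewrite cats0 eval_relabel eu.
- apply: multilinear_trees => //.
  by rewrite size_map size_copiesl.
Qed.

Definition sem W (xs : seq H) (E : expr) (g : seq H -> W) : W :=
  msw xs E.1 (fun s => g (map (eval s) E.2)).

(** Testing against every multilinear function of the outputs, rather than comparing
    tensors, is what allows an equivalence to be used in any context. *)
Definition equiv (E E' : expr) :=
  [/\ size E.1 = size E'.1, size E.2 = size E'.2 &
    forall W xs (g : seq H -> W), size xs = size E.1 -> multilinear (size E.2) g ->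
      sem xs E g = sem xs E' g].

Lemma equiv_refl E : equiv E E. Proof. by []. Qed.
Lemma equiv_sym E E' : equiv E E' -> equiv E' E.
Proof. by case=> e1 e2 h; split=> // W xs g exs lg; rewrite h ?e1 ?e2. Qed.
Lemma equiv_trans F E E' : equiv E F -> equiv F E' -> equiv E E'.
Proof.
case=> e1 e2 h [e1' e2' h']; split; [by rewrite e1|by rewrite e2|].
by move=> W xs g exs lg; rewrite h // h' -?e1 -?e2.
Qed.

Lemma eval_subst u K t : all (fun l => l < size K)%N (leaves t) ->
  eval u (subst (nth One K) t) = eval (map (eval u) K) t.
Proof.
elim: t => //= [l|a IH|o a IHa b IHb].
- by rewrite andbT => h; rewrite (nth_map One).
- by move/IH->.
- by rewrite all_cat => /andP[/IHa-> /IHb->].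
Qed.

Lemma sem_comp W D A xs (g : seq H -> W) :
  comp_ok D A -> size xs = size A.1 -> multilinear (size D.2) g ->
  sem xs (comp D A) g =
  msw xs A.1 (fun s => sem (map (eval s) A.2) D g).
Proof.
move=> ok exs lg; have /and4P[/eqP sA wA wD wK] := ok.
rewrite msw_comp //; last exact: multilinear_trees.
apply: eq_msw => [|u _].
  rewrite exs size_map size_reshape //.
congr g; rewrite -map_comp; apply/eq_in_map => t ht /=; rewrite eval_subst //.
rewrite size_map size_copiesl //; apply/allP => l hl.
have : l \in leavesl D.2 by apply/flattenP; exists (leaves t) => //; apply: map_f.
by rewrite (perm_mem wD) mem_iota.
Qed.

(** An equivalence holds for all values of its variables, in particular for those
    computed by [A]. *)
Lemma equiv_compl L R A : equiv L R -> comp_ok L A -> comp_ok R A ->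
  equiv (comp L A) (comp R A).
Proof.
case=> e1 e2 h okL okR; have /and4P[/eqP sA _ _ _] := okL.
have ns D : size (comp_ns D A) = size A.1 by rewrite size_map size_reshape.
split; rewrite ?ns ?size_map // => W xs g exs lg.
rewrite !sem_comp -?e2 //.
by apply: eq_msw => // s _; apply: h; rewrite ?size_map.
Qed.

Lemma multilinear_sem W E (g : seq H -> W) : wf E -> multilinear (size E.2) g ->
  multilinear (size E.1) (fun xs => sem xs E g).
Proof. by move=> wE lg; apply: msw_mlin; apply: multilinear_trees. Qed.

(** Outputs may be comultiplied by [D]: this only changes the multilinear function
    against which they are tested. *)
Lemma equiv_compr D E E' : equiv E E' -> comp_ok D E -> comp_ok D E' ->
  equiv (comp D E) (comp D E').
Proof.
case=> e1 e2 h ok ok'; have /and4P[/eqP sA _ wD _] := ok.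
have ns A : size (comp_ns D A) = size A.1 by rewrite size_map size_reshape.
split; rewrite ?ns ?size_map // => W xs g exs lg.
rewrite !sem_comp -?e1 //; apply: (h _ _ (fun r => sem r D g)) => //.
by rewrite sA; apply: multilinear_sem.
Qed.

Lemma equiv_extend n L R : equiv L R -> wf L -> wf R -> equiv (extend n L) (extend n R).
Proof.
case=> e1 e2 h wL wR; split; rewrite ?size_cat ?size_map ?size_iota ?e1 ?e2 ?size_nseq //.
move=> W xs g exs lg.
have sem_extend E : size E.1 = size L.1 -> size E.2 = size L.2 -> wf E ->
    sem xs (extend n E) g = sem (take (size E.1) xs) E (fun o => g (o ++ drop (size E.1) xs)).
  move=> e1' e2' wE; rewrite /sem /= -{1}(cat_take_drop (size E.1) xs).
  have st : size (take (size E.1) xs) = size E.1.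
    by rewrite size_takel // exs e1' e1 leq_addr.
  have sd : size (drop (size E.1) xs) = n.
    by rewrite size_drop exs e1' e1 addKn.
  rewrite msw_cat //; apply: eq_msw => // s es.
  transitivity (msw (drop (size E.1) xs) (nseq n 1%N) (fun t => g (map (eval s) E.2 ++ t))).
    apply: eq_msw => [|t]; first by rewrite sd size_nseq.
    rewrite sumn_nseq mul1n => et; congr g; rewrite map_cat; congr (_ ++ _).
      apply/eq_in_map => u hu; apply: eval_eq => l hl; rewrite nth_cat.
      have : l \in leavesl E.2 by apply/flattenP; exists (leaves u) => //; apply: map_f.
      by rewrite (perm_mem wE) mem_iota es => /andP[_ ->].
    apply: (@eq_from_nth _ 0); first by rewrite !size_map size_iota et.
    move=> i; rewrite !size_map size_iota => hi.
    rewrite -map_comp (nth_map 0%N) ?size_iota //= nth_iota // nth_cat -es.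
    by rewrite ltnNge leq_addr /= addKn.
  rewrite -sd msw_ones // sd; apply: multilinear_catr lg _.
  by rewrite size_map e2' e2.
rewrite !sem_extend // -e1; apply: h.
  by rewrite size_takel // exs e1 leq_addr.
apply: multilinear_catl; first by rewrite e2; exact: lg.
by rewrite size_drop exs e1 addKn.
Qed.

Lemma equiv_instance n L R C A : equiv L R -> instance_ok n L C A -> instance_ok n R C A ->
  equiv (instance n L C A) (instance n R C A).
Proof.
move=> LR /and3P[wL okL okCL] /and3P[wR okR okCR].
by apply: equiv_compr => //; apply: equiv_compl => //; apply: equiv_extend.
Qed.

Lemma rewritesP L R E E' : equiv L R -> E' \in rewrites L R E -> equiv E E'.
Proof.
move=> LR; rewrite /rewrites mem_pmap => /mapP[c _]; case: (candidate L E c) => -[n C] A.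
by case: ifP => // /and3P[/eqP-> okL okR] [->]; apply: equiv_instance.
Qed.

Fixpoint sound rs := if rs is r :: rs' then equiv r.1 r.2 /\ sound rs' else True.

Lemma sound_cat rs rs' : sound rs -> sound rs' -> sound (rs ++ rs').
Proof. by elim: rs => //= r rs IH [h /IH{}IH] /IH. Qed.

Lemma normalizeP n rs E : sound rs -> equiv E (normalize n rs E).
Proof.
move=> srs; elim: n E => [|n IH] E /=; first exact: equiv_refl.
case e: (normalize1 rs E) => [E'|]; last exact: equiv_refl.
apply: equiv_trans (IH E'); elim: rs srs e {IH} => //= r rs IH [h srs].
case eR: (rewrites r.1 r.2 E) => [|E1 s]; first exact: IH.
by case=> <-; apply: rewritesP h _; rewrite eR inE eqxx.
Qed.

Lemma step rs L R E E' : sound rs -> equiv L R -> reaches rs L R E E' -> equiv E E'.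
Proof.
move=> srs LR /hasP[E'' hE'' /eqP e].
apply: equiv_trans (rewritesP LR hE'') _.
apply: equiv_trans (normalizeP fuel _ srs) _; rewrite e.
exact/equiv_sym/normalizeP.
Qed.

Lemma same_normal_form rs E E' : sound rs ->
  normalize fuel rs E == normalize fuel rs E' -> equiv E E'.
Proof.
move=> srs /eqP e; apply: equiv_trans (normalizeP fuel _ srs) _; rewrite e.
exact/equiv_sym/normalizeP.
Qed.

(** * Expressions with one or two outputs *)

Definition value xs (E : expr) : H := nest_msw HH xs E.1 (fun s => eval s (nth One E.2 0)).
Definition value2 xs (E : expr) : H \ot H :=
  nest_msw HH xs E.1 (fun s => eval s (nth One E.2 0) \ox eval s (nth One E.2 1)).

Definition out n (E : expr) := (size E.2 == n) && wf E.

Lemma multilinear_hd : multilinear 1 (fun s : seq H => nth 0 s 0).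
Proof. by move=> [|? [|? ?]] [|? ?] //= _ a x y. Qed.
Lemma multilinear_tens : multilinear 2 (fun s : seq H => nth 0 s 0 \ox nth 0 s 1).
Proof. by move=> [|? [|? [|? ?]]] [|? [|? ?]] //= _; lin_tac. Qed.

Lemma sem_value xs E : out 1 E -> size xs = size E.1 ->
  sem xs E (fun s => nth 0 s 0) = value xs E.
Proof.
case: E => ns [|e [|? ?]] //= /andP[_ wE] exs.
rewrite /sem /value -nest_mswE //=.
exact: (multilinear_trees wE multilinear_hd).
Qed.

Lemma sem_value2 xs E : out 2 E -> size xs = size E.1 ->
  sem xs E (fun s => nth 0 s 0 \ox nth 0 s 1) = value2 xs E.
Proof.
case: E => ns [|e [|e' [|? ?]]] //= /andP[_ wE] exs.
rewrite /sem /value2 -nest_mswE //=.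
exact: (multilinear_trees wE multilinear_tens).
Qed.

Lemma equiv_value E E' : equiv E E' -> out 1 E -> out 1 E' ->
  forall xs, size xs = size E.1 -> value xs E = value xs E'.
Proof.
move=> [e1 e2 h] oE oE' xs exs; rewrite -!sem_value -?e1 //.
by apply: h; rewrite // (eqP (andP oE).1); exact: multilinear_hd.
Qed.

Lemma equiv_value2 E E' : equiv E E' -> out 2 E -> out 2 E' ->
  forall xs, size xs = size E.1 -> value2 xs E = value2 xs E'.
Proof.
move=> [e1 e2 h] oE oE' xs exs; rewrite -!sem_value2 -?e1 //.
by apply: h; rewrite // (eqP (andP oE).1); exact: multilinear_tens.
Qed.

Lemma value_equiv E E' : size E.1 = size E'.1 -> out 1 E -> out 1 E' ->
  (forall xs, size xs = size E.1 -> value xs E = value xs E') -> equiv E E'.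
Proof.
move=> e1 oE oE' h; have [/eqP s1 _] := andP oE; have [/eqP s2 _] := andP oE'.
split=> //; first by rewrite s1.
move=> W xs g exs; rewrite s1 => lg.
have lg1 : linear (fun y => g [:: y]) by apply: (lg [::] [::]).
have semE F : out 1 F -> size xs = size F.1 -> sem xs F g = g [:: value xs F].
  move=> oF eF; rewrite -sem_value // /sem (msw_pull _ _ _ _ lg1).
  by apply: eq_msw => // s _; case: F oF {eF} => ns [|? [|? ?]].
by rewrite !semE -?e1 // h.
Qed.

Lemma value2_equiv E E' : size E.1 = size E'.1 -> out 2 E -> out 2 E' ->
  (forall xs, size xs = size E.1 -> value2 xs E = value2 xs E') -> equiv E E'.
Proof.
move=> e1 oE oE' h; have [/eqP s1 _] := andP oE; have [/eqP s2 _] := andP oE'.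
split=> //; first by rewrite s1.
move=> W xs g exs; rewrite s1 => lg.
have bg : bilin (fun a b => g [:: a; b]).
  by split=> [b|a]; [apply: (lg [::] [:: b])|apply: (lg [:: a] [::])].
have semE F : out 2 F -> size xs = size F.1 ->
    sem xs F g = tensor_lift (fun a b => g [:: a; b]) (value2 xs F).
  move=> oF eF; rewrite -sem_value2 // /sem (msw_pull _ _ _ _ (tensor_lift_linear bg)).
  apply: eq_msw => // s _; rewrite tensor_liftE //.
  by case: F oF {eF} => ns [|? [|? [|? ?]]].
by rewrite !semE -?e1 // h.
Qed.

Lemma value_comp D A xs : comp_ok D A -> out 1 D -> out 1 (comp D A) ->
  size xs = size A.1 ->
  nest_msw HH xs A.1 (fun s => value (map (eval s) A.2) D) = value xs (comp D A).
Proof.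
move=> ok oD oDA exs; have /and4P[/eqP sA wA wD _] := ok.
rewrite -sem_value //; last by rewrite size_map size_reshape.
have l1 : multilinear (size D.2) (fun s : seq H => nth 0 s 0).
  by rewrite (eqP (andP oD).1); exact: multilinear_hd.
rewrite (sem_comp ok exs l1) -nest_mswE //.
- by apply: eq_msw => // s _; rewrite sem_value // size_map.
- have -> : (fun s => value (map (eval s) A.2) D) =
            (fun s => sem (map (eval s) A.2) D (fun s => nth 0 s 0)).
    by apply: boolp.funext => s; rewrite sem_value // size_map.
  apply: (multilinear_trees (f := fun r => sem r D (fun s => nth 0 s 0)) wA).
  by rewrite sA; exact: multilinear_sem.
Qed.

(** Expressions with two variables and two outputs act on [H \ot H], and composing
    them composes these maps; left regularity is proved in this form. *)
Definition expr_map (E : expr) (t : H \ot H) : H \ot H :=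
  \sw_(x, y <- t) value2 [:: x; y] E.

Definition endo E := out 2 E && (size E.1 == 2%N).

Lemma value2_bilin E : endo E -> bilin (fun x y => value2 [:: x; y] E).
Proof.
move=> /andP[oE /eqP s2]; have [/eqP o2 wE] := andP oE.
have lm : multilinear 2 (fun xs => sem xs E (fun s => nth 0 s 0 \ox nth 0 s 1)).
  by rewrite -s2; apply: multilinear_sem => //; rewrite o2; exact: multilinear_tens.
split=> [y|x] a u v; rewrite -!sem_value2 //.
  exact: (lm [::] [:: y]).
exact: (lm [:: x] [::]).
Qed.

Lemma expr_mapE E x y : endo E -> expr_map E (x \ox y) = value2 [:: x; y] E.
Proof. by move=> eE; apply: tensor_liftE; exact: value2_bilin. Qed.
Lemma expr_map_linear E : endo E -> linear (expr_map E).
Proof. by move=> eE; apply: tensor_lift_linear; exact: value2_bilin. Qed.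

Lemma expr_map_comp D A t : comp_ok D A -> endo D -> endo A -> endo (comp D A) ->
  expr_map D (expr_map A t) = expr_map (comp D A) t.
Proof.
move=> ok eD eA eDA; move: t; apply: tensor_eq_lin => [||x y].
- exact: lin_comp (expr_map_linear eD) (expr_map_linear eA).
- exact: expr_map_linear.
rewrite !expr_mapE //; have [oA /eqP sA] := andP eA; have [oD /eqP sD] := andP eD.
have [oDA /eqP sDA] := andP eDA.
rewrite -!sem_value2 // (sem_comp ok) ?sA //; last first.
  by rewrite (eqP (andP oD).1); exact: multilinear_tens.
rewrite /sem (msw_pull _ _ _ _ (expr_map_linear eD)); apply: eq_msw; first by rewrite sA.
move=> s _; rewrite expr_mapE // -sem_value2 //.
by case: A oA {ok eA eDA oDA sA sDA} => ns [|? [|? [|? ?]]].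
Qed.

Lemma equiv_expr_map E E' : equiv E E' -> endo E -> endo E' -> expr_map E =1 expr_map E'.
Proof.
move=> EE' /andP[oE /eqP sE] /andP[oE' /eqP sE'] t; apply: eq_sw => x y.
by apply: equiv_value2; rewrite ?sE.
Qed.

(** * The rules of Hopf algebras and modules *)

Declare Scope tree_scope.
Delimit Scope tree_scope with T.
Local Notation "a * b" := (Op OMul a b) : tree_scope.
Local Notation "a \d b" := (Op ODot a b) (at level 40, left associativity) : tree_scope.
Local Notation "a \c b" := (Op OCol a b) (at level 40, left associativity) : tree_scope.
Local Notation "1" := One : tree_scope.
Local Notation "\S a" := (Anti a) (at level 30, right associativity) : tree_scope.
Local Notation X := (slot 0).
Local Notation Y := (slot 1).
Local Notation Z := (slot 2).
Local Notation "<{ p | ts }>" := (expr_of p ts%T) (at level 0, p at level 0, ts at level 99).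
Local Notation "[ ts '=[' p ']' us ]" := (equiv (expr_of p ts%T) (expr_of p us%T))
  (at level 0, ts, us at level 99, p at level 0).

Lemma equiv1P ts us : out 1 (expr_of 1 ts) -> out 1 (expr_of 1 us) ->
  equiv (expr_of 1 ts) (expr_of 1 us) <->
  (forall x, value [:: x] (expr_of 1 ts) = value [:: x] (expr_of 1 us)).
Proof.
move=> o o'; split=> [e x|e]; first exact: equiv_value.
by apply: value_equiv => // -[|x [|? ?]].
Qed.
Lemma equiv2P ts us : out 1 (expr_of 2 ts) -> out 1 (expr_of 2 us) ->
  equiv (expr_of 2 ts) (expr_of 2 us) <->
  (forall x y, value [:: x; y] (expr_of 2 ts) = value [:: x; y] (expr_of 2 us)).
Proof.
move=> o o'; split=> [e x y|e]; first exact: equiv_value.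
by apply: value_equiv => // -[|x [|y [|? ?]]].
Qed.
Lemma equiv3P ts us : out 1 (expr_of 3 ts) -> out 1 (expr_of 3 us) ->
  equiv (expr_of 3 ts) (expr_of 3 us) <->
  (forall x y z, value [:: x; y; z] (expr_of 3 ts) = value [:: x; y; z] (expr_of 3 us)).
Proof.
move=> o o'; split=> [e x y z|e]; first exact: equiv_value.
by apply: value_equiv => // -[|x [|y [|z [|? ?]]]].
Qed.

Ltac norm_expr := repeat match goal with |- context [expr_of ?p ?ts] =>
  let v := eval vm_compute in (expr_of p ts) in change (expr_of p ts) with v end.
Ltac unfold_value := norm_expr; rewrite /value /=.
Ltac read1 := apply/equiv1P => //; unfold_value.
Ltac read2 := apply/equiv2P => //; unfold_value.
Ltac read3 := apply/equiv3P => //; unfold_value.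

Local Notation rl p a b := (<{ p | a }>, <{ p | b }>).

(** Rules are tried in order; cancellations come before the reassociation that could
    hide them. *)
Definition algebra_rules : seq (expr * expr) := [::
  rl 1 [:: 1 * X 1] [:: X 1];
  rl 1 [:: X 1 * 1] [:: X 1];
  rl 1 [:: \S X 1 * X 2] [:: 1];
  rl 1 [:: X 1 * \S X 2] [:: 1];
  rl 0 [:: \S 1] [:: 1];
  rl 2 [:: \S (X 1 * Y 1)] [:: \S Y 1 * \S X 1];
  rl 3 [:: (X 1 * Y 1) * Z 1] [:: X 1 * (Y 1 * Z 1)]].

Lemma algebra_rules_sound : sound algebra_rules.
Proof.
do !apply: conj; cbn [fst snd].
- by read1 => x; rewrite mul1r.
- by read1 => x; rewrite mulr1.
- by read1 => x; rewrite antipodel.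
- by read1 => x; rewrite antipoder.
- by apply: value_equiv => // -[|//] _; norm_expr; rewrite /value /= antipode1.
- by read2 => x y; rewrite antipodeM.
- by read3 => x y z; rewrite mulrA.
- by [].
Qed.

Lemma equiv_eq E F E' F' : equiv E F -> E = E' -> F = F' -> equiv E' F'.
Proof. by move=> ? <- <-. Qed.
Ltac by_computation_from e := apply: (equiv_eq e); vm_compute; reflexivity.

Ltac by_normalization_using snd := apply: same_normal_form snd _; vm_compute; reflexivity.
Ltac by_step_using snd lem := first
  [ apply: (step snd lem); vm_compute; reflexivity
  | apply: (step snd (equiv_sym lem)); vm_compute; reflexivity ].
Ltac through F := apply: (equiv_trans (F := F)).

Lemma mul_assoc : [ [:: (X 1 * Y 1) * Z 1] =[3] [:: X 1 * (Y 1 * Z 1)] ].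
Proof. by read3 => x y z; rewrite mulrA. Qed.

Definition hopf_rules : seq (expr * expr) := [::
  rl 2 [:: \S X 1 * (X 2 * Y 1)] [:: Y 1];
  rl 2 [:: X 1 * (\S X 2 * Y 1)] [:: Y 1]] ++ algebra_rules.

Lemma hopf_rules_sound : sound hopf_rules.
Proof.
by split; [|split]; [by_step_using algebra_rules_sound mul_assoc..|
  exact: algebra_rules_sound].
Qed.

Lemma exchange_rule : [ [:: X 1 \d Y 2; Y 1 \c X 2] =[2] [:: X 2 \d Y 1; Y 2 \c X 1] ].
Proof.
apply: value2_equiv => // -[|x [|y [|? ?]]] // _; norm_expr; rewrite /value2 /=.
exact: q_magma_exchange.
Qed.

Lemma times1E l : times HH dot 1 l = dot (l \ox 1).
Proof.
by rewrite /times comul_one tensor_liftE ?mulr1 //; split=> ?; lin_tac.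
Qed.
Lemma boxtimes1E l : boxtimes HH colon 1 l = colon (l \ox 1).
Proof.
by rewrite /boxtimes comul_one tensor_liftE ?mulr1 //; split=> ?; lin_tac.
Qed.

Definition id_expr := <{ 2 | [:: X 1; Y 1] }>.
Definition left_regular_expr := <{ 2 | [:: X 1 \d Y 1; Y 2] }>.

Lemma expr_map_id t : expr_map id_expr t = t.
Proof.
rewrite /id_expr; norm_expr; rewrite [RHS]tensor_sumE.
by apply: eq_bigr => p _; rewrite /value2.
Qed.

Section Modules.
Hypotheses (dot_module : right_op_module dot) (colon_module : right_op_module colon).

Lemma dot_mul : [ [:: X 1 \d (Y 1 * Z 1)] =[3] [:: (X 1 \d Z 1) \d Y 1] ].
Proof. by read3; case: dot_module. Qed.
Lemma colon_mul : [ [:: X 1 \c (Y 1 * Z 1)] =[3] [:: (X 1 \c Z 1) \c Y 1] ].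
Proof. by read3; case: colon_module. Qed.

Definition unit_rules : seq (expr * expr) :=
  [:: rl 1 [:: X 1 \d 1] [:: X 1]; rl 1 [:: X 1 \c 1] [:: X 1]] ++ hopf_rules.

Lemma unit_rules_sound : sound unit_rules.
Proof.
split; [|split; [|exact: hopf_rules_sound]].
- by read1; case: dot_module.
- by read1; case: colon_module.
Qed.

(** Orienting a module law from left to right separates the factors of an acting
    product, so the cancellations have to be available for successive actions
    too. *)
Definition module_rules : seq (expr * expr) := unit_rules ++ [::
  rl 2 [:: (X 1 \d Y 2) \d \S Y 1] [:: X 1];
  rl 2 [:: (X 1 \c Y 2) \c \S Y 1] [:: X 1];
  rl 2 [:: (X 1 \d \S Y 2) \d Y 1] [:: X 1];
  rl 2 [:: (X 1 \c \S Y 2) \c Y 1] [:: X 1];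
  rl 3 [:: X 1 \d (Y 1 * Z 1)] [:: (X 1 \d Z 1) \d Y 1];
  rl 3 [:: X 1 \c (Y 1 * Z 1)] [:: (X 1 \c Z 1) \c Y 1]].

Lemma module_rules_sound : sound module_rules.
Proof.
rewrite /module_rules; apply: sound_cat; first exact: unit_rules_sound.
do !apply: conj; cbn [fst snd].
- by_step_using unit_rules_sound dot_mul.
- by_step_using unit_rules_sound colon_mul.
- by_step_using unit_rules_sound dot_mul.
- by_step_using unit_rules_sound colon_mul.
- exact: dot_mul.
- exact: colon_mul.
- by [].
Qed.

Ltac by_normalization := by_normalization_using module_rules_sound.
Ltac by_step lem := by_step_using module_rules_sound lem.

Lemma one_dot_swap : [ [:: 1 \d X 2; X 1] =[1] [:: 1 \d X 1; X 2] ].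
Proof.
through <{ 1 | [:: 1 \d X 2; X 1 \c 1] }>; first by_normalization.
by_step exchange_rule.
Qed.

Lemma one_colon_swap : [ [:: 1 \c X 2; X 1] =[1] [:: 1 \c X 1; X 2] ].
Proof.
through <{ 1 | [:: 1 \c X 2; X 1 \d 1] }>; first by_normalization.
by_step exchange_rule.
Qed.

(** [u x = 1 \d x] is a coalgebra map from [H^cop] to [H], hence invertible for the
    convolution of [H^cop]; an invertible idempotent is the unit. *)
Lemma one_dot_of_idem : [ [:: 1 \d X 1] =[1] [:: (1 \d X 2) * (1 \d X 1)] ] ->
  [ [:: 1 \d X 1] =[1] [:: 1] ].
Proof.
move=> idem.
through <{ 1 | [:: \S (1 \d X 3) * ((1 \d X 2) * (1 \d X 1))] }>.
  by_normalization.
apply: equiv_sym; through <{ 1 | [:: \S (1 \d X 2) * (1 \d X 1)] }>.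
  by_normalization.
by_step idem.
Qed.

Lemma one_colon_of_idem : [ [:: 1 \c X 1] =[1] [:: (1 \c X 2) * (1 \c X 1)] ] ->
  [ [:: 1 \c X 1] =[1] [:: 1] ].
Proof.
move=> idem.
through <{ 1 | [:: \S (1 \c X 3) * ((1 \c X 2) * (1 \c X 1))] }>.
  by_normalization.
apply: equiv_sym; through <{ 1 | [:: \S (1 \c X 2) * (1 \c X 1)] }>.
  by_normalization.
by_step idem.
Qed.

(** * The identities of the statement as expressions *)

(** The variables are ordered by the nesting of the sums in the definitions, so that
    the two forms agree by computation. *)
Definition brace_dot :=
  [ [:: (X 1 * Z 1) \d Y 1] =[3] [:: (X 1 \d (Y 1 \c Z 2)) * (Z 1 \d Y 2)] ].
Definition brace_colon :=
  [ [:: (X 1 * Z 1) \c Y 1] =[3] [:: (X 1 \c (Y 1 \d Z 2)) * (Z 1 \c Y 2)] ].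
Definition cycle1 :=
  [ [:: (X 1 \d Y 1) \d (Z 1 \c Y 2)] =[3] [:: (X 1 \d Z 2) \d (Y 1 \d Z 1)] ].
Definition cycle2 :=
  [ [:: (X 1 \d Y 1) \c (Z 1 \d Y 2)] =[3] [:: (X 1 \c Z 2) \d (Y 1 \c Z 1)] ].
Definition cycle3 :=
  [ [:: (X 1 \c Y 1) \c (Z 1 \c Y 2)] =[3] [:: (X 1 \c Z 2) \c (Y 1 \d Z 1)] ].

Lemma brace_dotP : brace_dot <-> forall h m l, dot ((h * m) \ox l) =
  \sw_(l1, l2 <- comul HH l) \sw_(m1, m2 <- comul HH m)
    dot (h \ox colon (l1 \ox m2)) * dot (m1 \ox l2).
Proof.
split=> [/equiv3P e h m l|e]; last by read3 => x y z; exact: e.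
by have := e isT isT h l m; unfold_value.
Qed.
Lemma brace_colonP : brace_colon <-> forall h m l, colon ((h * m) \ox l) =
  \sw_(l1, l2 <- comul HH l) \sw_(m1, m2 <- comul HH m)
    colon (h \ox dot (l1 \ox m2)) * colon (m1 \ox l2).
Proof.
split=> [/equiv3P e h m l|e]; last by read3 => x y z; exact: e.
by have := e isT isT h l m; unfold_value.
Qed.
Lemma cycle1P : cycle1 <-> forall x y z,
  \sw_(y1, y2 <- comul HH y) (dot (dot (x \ox y1) \ox colon (z \ox y2))) =
  \sw_(z1, z2 <- comul HH z) (dot (dot (x \ox z2) \ox dot (y \ox z1))).
Proof.
split=> [/equiv3P e x y z|e]; last by read3 => x y z; exact: e.
by have := e isT isT x y z; unfold_value.
Qed.
Lemma cycle2P : cycle2 <-> forall x y z,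
  \sw_(y1, y2 <- comul HH y) (colon (dot (x \ox y1) \ox dot (z \ox y2))) =
  \sw_(z1, z2 <- comul HH z) (dot (colon (x \ox z2) \ox colon (y \ox z1))).
Proof.
split=> [/equiv3P e x y z|e]; last by read3 => x y z; exact: e.
by have := e isT isT x y z; unfold_value.
Qed.
Lemma cycle3P : cycle3 <-> forall x y z,
  \sw_(y1, y2 <- comul HH y) (colon (colon (x \ox y1) \ox colon (z \ox y2))) =
  \sw_(z1, z2 <- comul HH z) (colon (colon (x \ox z2) \ox dot (y \ox z1))).
Proof.
split=> [/equiv3P e x y z|e]; last by read3 => x y z; exact: e.
by have := e isT isT x y z; unfold_value.
Qed.

Local Notation times := (times HH dot).
Local Notation boxtimes := (boxtimes HH colon).
Definition times_expr := <{ 2 | [:: (Y 1 \d X 1) * X 2] }>.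
Definition boxtimes_expr := <{ 2 | [:: (Y 1 \c X 2) * X 1] }>.

Lemma timesE h l : times h l = value [:: h; l] times_expr.
Proof. by rewrite /times_expr; unfold_value. Qed.
Lemma boxtimesE h l : boxtimes h l = value [:: h; l] boxtimes_expr.
Proof. by rewrite /boxtimes_expr; unfold_value. Qed.

Lemma times_linl l : linear (times^~ l). Proof. by rewrite /Defs.times; lin_tac. Qed.
Lemma times_linr h : linear (times h). Proof. by rewrite /Defs.times; lin_tac. Qed.
Lemma boxtimes_linl l : linear (boxtimes^~ l).
Proof. by rewrite /Defs.boxtimes; lin_tac. Qed.
Lemma boxtimes_linr h : linear (boxtimes h).
Proof. by rewrite /Defs.boxtimes; lin_tac. Qed.

Definition times_assoc := [ [:: (((Z 1 \d Y 1) * Y 2) \d X 1) * X 2] =[3]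
   [:: (Z 1 \d ((Y 1 \d X 2) * X 3)) * ((Y 2 \d X 1) * X 4)] ].
Definition boxtimes_assoc := [ [:: (((Z 1 \c Y 2) * Y 1) \c X 2) * X 1] =[3]
   [:: (Z 1 \c ((Y 2 \c X 3) * X 2)) * ((Y 1 \c X 4) * X 1)] ].

Lemma times_assocP : times_assoc <-> associative times.
Proof.
have l x y z : value [:: x; y; z] <{ 3 | [:: (((Z 1 \d Y 1) * Y 2) \d X 1) * X 2] }> =
    times x (times y z).
  pose A := <{ 3 | [:: X 1; (Z 1 \d Y 1) * Y 2] }>.
  transitivity (value [:: x; y; z] (comp times_expr A)); first by congr value.
  rewrite -value_comp // [in RHS]/(times y z) (sw_lin _ _ (times_linr x)).
  by rewrite /A; norm_expr; apply: eq_sw => y1 y2; rewrite timesE.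
have r x y z : value [:: x; y; z]
    <{ 3 | [:: (Z 1 \d ((Y 1 \d X 2) * X 3)) * ((Y 2 \d X 1) * X 4)] }> =
    times (times x y) z.
  pose A := <{ 3 | [:: (Y 1 \d X 1) * X 2; Z 1] }>.
  transitivity (value [:: x; y; z] (comp times_expr A)); first by congr value.
  rewrite -value_comp // [in RHS]/(times x y) (sw_lin _ _ (times_linl z)).
  by rewrite /A; norm_expr; apply: eq_sw => y1 y2; rewrite timesE.
rewrite /times_assoc; split=> [/equiv3P e x y z|e].
  by rewrite -l e // r.
by apply/equiv3P => // x y z; rewrite l r.
Qed.

Lemma boxtimes_assocP : boxtimes_assoc <-> associative boxtimes.
Proof.
have l x y z : value [:: x; y; z] <{ 3 | [:: (((Z 1 \c Y 2) * Y 1) \c X 2) * X 1] }> =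
    boxtimes x (boxtimes y z).
  pose A := <{ 3 | [:: X 1; (Z 1 \c Y 2) * Y 1] }>.
  transitivity (value [:: x; y; z] (comp boxtimes_expr A)); first by congr value.
  rewrite -value_comp // [in RHS]/(boxtimes y z) (sw_lin _ _ (boxtimes_linr x)).
  by rewrite /A; norm_expr; apply: eq_sw => y1 y2; rewrite boxtimesE.
have r x y z : value [:: x; y; z]
    <{ 3 | [:: (Z 1 \c ((Y 2 \c X 3) * X 2)) * ((Y 1 \c X 4) * X 1)] }> =
    boxtimes (boxtimes x y) z.
  pose A := <{ 3 | [:: (Y 1 \c X 2) * X 1; Z 1] }>.
  transitivity (value [:: x; y; z] (comp boxtimes_expr A)); first by congr value.
  rewrite -value_comp // [in RHS]/(boxtimes x y) (sw_lin _ _ (boxtimes_linl z)).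
  by rewrite /A; norm_expr; apply: eq_sw => y1 y2; rewrite boxtimesE.
rewrite /boxtimes_assoc; split=> [/equiv3P e x y z|e].
  by rewrite -l e // r.
by apply/equiv3P => // x y z; rewrite l r.
Qed.

Definition rule_a2 := [ [:: ((Z 1 \c Y 2) * Y 1) \d X 1] =[3]
   [:: ((Z 1 \d X 1) \c (Y 2 \d X 2)) * (Y 1 \d X 3)] ].
Definition rule_b2 := [ [:: ((Z 1 \d Y 1) * Y 2) \c X 1] =[3]
   [:: ((Z 1 \c X 3) \d (Y 1 \c X 2)) * (Y 2 \c X 1)] ].
Definition rule_a3 :=
  [ [:: X 1 \d ((Z 1 \d Y 1) * Y 2)] =[3] [:: X 1 \d ((Y 1 \c Z 2) * Z 1)] ].
Definition rule_b3 :=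
  [ [:: X 1 \c ((Z 1 \d Y 1) * Y 2)] =[3] [:: X 1 \c ((Y 1 \c Z 2) * Z 1)] ].

Lemma rule_a2P : rule_a2 <-> eq_a2 HH dot colon.
Proof.
have l h m n : value [:: h; m; n] <{ 3 | [:: ((Z 1 \c Y 2) * Y 1) \d X 1] }> =
    dot (boxtimes m n \ox h).
  unfold_value; rewrite [in RHS]/(boxtimes m n).
  by rewrite (sw_lin (F := fun t => dot (t \ox h))) //; lin_tac.
have r h m n : value [:: h; m; n] <{ 3 | [:: ((Z 1 \d X 1) \c (Y 2 \d X 2)) * (Y 1 \d X 3)] }> =
    \sw_(h1, h2 <- comul HH h) boxtimes (dot (m \ox h2)) (dot (n \ox h1)).
  pose A := <{ 3 | [:: Y 1 \d X 2; Z 1 \d X 1] }>.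
  transitivity (value [:: h; m; n] (comp boxtimes_expr A)); first by congr value.
  by rewrite -value_comp // /A; norm_expr; apply: eq_sw => h1 h2; rewrite boxtimesE.
rewrite /rule_a2; split=> [/equiv3P e h m n|e]; first by rewrite -l -r e.
by apply/equiv3P => // h m n; rewrite l r.
Qed.

Lemma rule_b2P : rule_b2 <-> eq_b2 HH dot colon.
Proof.
have l h m n : value [:: h; m; n] <{ 3 | [:: ((Z 1 \d Y 1) * Y 2) \c X 1] }> =
    colon (times m n \ox h).
  unfold_value; rewrite [in RHS]/(times m n).
  by rewrite (sw_lin (F := fun t => colon (t \ox h))) //; lin_tac.
have r h m n : value [:: h; m; n] <{ 3 | [:: ((Z 1 \c X 3) \d (Y 1 \c X 2)) * (Y 2 \c X 1)] }> =
    \sw_(h1, h2 <- comul HH h) times (colon (m \ox h1)) (colon (n \ox h2)).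
  pose A := <{ 3 | [:: Y 1 \c X 1; Z 1 \c X 2] }>.
  transitivity (value [:: h; m; n] (comp times_expr A)); first by congr value.
  by rewrite -value_comp // /A; norm_expr; apply: eq_sw => h1 h2; rewrite timesE.
rewrite /rule_b2; split=> [/equiv3P e h m n|e]; first by rewrite -l -r e.
by apply/equiv3P => // h m n; rewrite l r.
Qed.

Lemma rule_a3P : rule_a3 <-> eq_a3 HH dot colon.
Proof.
have l h m n : value [:: h; m; n] <{ 3 | [:: X 1 \d ((Z 1 \d Y 1) * Y 2)] }> =
    dot (h \ox times m n).
  by unfold_value; rewrite (sw_lin (F := fun t => dot (h \ox t))) //; lin_tac.
have r h m n : value [:: h; m; n] <{ 3 | [:: X 1 \d ((Y 1 \c Z 2) * Z 1)] }> =
    dot (h \ox boxtimes n m).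
  by unfold_value; rewrite (sw_lin (F := fun t => dot (h \ox t))) //; lin_tac.
rewrite /rule_a3; split=> [/equiv3P e h m n|e]; first by rewrite -l -r e.
by apply/equiv3P => // h m n; rewrite l r.
Qed.

Lemma rule_b3P : rule_b3 <-> eq_b3 HH dot colon.
Proof.
have l h m n : value [:: h; m; n] <{ 3 | [:: X 1 \c ((Z 1 \d Y 1) * Y 2)] }> =
    colon (h \ox times m n).
  by unfold_value; rewrite (sw_lin (F := fun t => colon (h \ox t))) //; lin_tac.
have r h m n : value [:: h; m; n] <{ 3 | [:: X 1 \c ((Y 1 \c Z 2) * Z 1)] }> =
    colon (h \ox boxtimes n m).
  by unfold_value; rewrite (sw_lin (F := fun t => colon (h \ox t))) //; lin_tac.
rewrite /rule_b3; split=> [/equiv3P e h m n|e]; first by rewrite -l -r e.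
by apply/equiv3P => // h m n; rewrite l r.
Qed.

(** * Hopf q-braces satisfy the identities *)

Lemma times_right1 : [ [:: 1 \d X 1] =[1] [:: 1] ] -> right_id 1 times.
Proof.
move=> one_dot h.
transitivity (value [:: h] <{ 1 | [:: (1 \d X 1) * X 2] }>); first by unfold_value.
transitivity (value [:: h] <{ 1 | [:: X 1] }>); last by unfold_value.
by apply: equiv_value => //; by_step one_dot.
Qed.
Lemma boxtimes_right1 : [ [:: 1 \c X 1] =[1] [:: 1] ] -> right_id 1 boxtimes.
Proof.
move=> one_colon h.
transitivity (value [:: h] <{ 1 | [:: (1 \c X 2) * X 1] }>); first by unfold_value.
transitivity (value [:: h] <{ 1 | [:: X 1] }>); last by unfold_value.
by apply: equiv_value => //; by_step one_colon.
Qed.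

Section FromBrace.
Hypotheses (hdot : brace_dot) (hcolon : brace_colon).
Hypotheses (h1 : cycle1) (h2 : cycle2) (h3 : cycle3).

Lemma one_dot_of_brace : [ [:: 1 \d X 1] =[1] [:: 1] ].
Proof.
apply: one_dot_of_idem.
through <{ 1 | [:: (1 * 1) \d X 1] }>; first by_normalization.
through <{ 1 | [:: (1 \d X 1) * (1 \d X 2)] }>; first by_step hdot.
by_step one_dot_swap.
Qed.

Lemma one_colon_of_brace : [ [:: 1 \c X 1] =[1] [:: 1] ].
Proof.
apply: one_colon_of_idem.
through <{ 1 | [:: (1 * 1) \c X 1] }>; first by_normalization.
through <{ 1 | [:: (1 \c X 1) * (1 \c X 2)] }>; first by_step hcolon.
by_step one_colon_swap.
Qed.

Lemma times_assoc_of_brace : times_assoc.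
Proof.
through <{ 3 | [:: (((Z 1 \d Y 1) \d (X 1 \c Y 3)) * (Y 2 \d X 2)) * X 3] }>.
  by_step hdot.
through <{ 3 | [:: (((Z 1 \d Y 1) \d (X 2 \c Y 2)) * (Y 3 \d X 1)) * X 3] }>.
  by_step exchange_rule.
by_step h1.
Qed.

Lemma boxtimes_assoc_of_brace : boxtimes_assoc.
Proof.
through <{ 3 | [:: (((Z 1 \c Y 3) \c (X 2 \d Y 2)) * (Y 1 \c X 3)) * X 1] }>.
  by_step hcolon.
by_step h3.
Qed.

Lemma a2_of_brace : rule_a2.
Proof.
through <{ 3 | [:: ((Z 1 \c Y 3) \d (X 1 \c Y 2)) * (Y 1 \d X 2)] }>.
  by_step hdot.
by_step h2.
Qed.

Lemma b2_of_brace : rule_b2.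
Proof.
through <{ 3 | [:: ((Z 1 \d Y 1) \c (X 1 \d Y 3)) * (Y 2 \c X 2)] }>.
  by_step hcolon.
through <{ 3 | [:: ((Z 1 \d Y 1) \c (X 2 \d Y 2)) * (Y 3 \c X 1)] }>.
  by_step exchange_rule.
by_step h2.
Qed.

Lemma a3_of_brace : rule_a3.
Proof.
through <{ 3 | [:: (X 1 \d Y 2) \d (Z 1 \d Y 1)] }>; first by_normalization.
by_step h1.
Qed.

Lemma b3_of_brace : rule_b3.
Proof.
through <{ 3 | [:: (X 1 \c Y 2) \c (Z 1 \d Y 1)] }>; first by_normalization.
by_step h3.
Qed.

End FromBrace.

(** * The identities yield a Hopf q-brace *)

Section ToBrace.
Hypotheses (timesA : times_assoc) (boxtimesA : boxtimes_assoc).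
Hypotheses (ha3 : rule_a3) (hb3 : rule_b3) (hb2 : rule_b2).

Lemma cycle1_of_a3 : cycle1.
Proof.
through <{ 3 | [:: X 1 \d ((Z 1 \c Y 2) * Y 1)] }>; first by_normalization.
by_step ha3.
Qed.

Lemma cycle3_of_b3 : cycle3.
Proof.
through <{ 3 | [:: X 1 \c ((Z 1 \c Y 2) * Y 1)] }>; first by_normalization.
by_step hb3.
Qed.

(** Associativity of [times], with the last factor cancelled by the antipode.  This is
    the law for hm.l on the elements [(z \d y1) \ox y2]. *)
Lemma dot_of_times : [ [:: ((Z 1 \d Y 1) * Y 2) \d X 1] =[3]
   [:: ((Z 1 \d Y 1) \d (X 2 \c Y 2)) * (Y 3 \d X 1)] ].
Proof.
through <{ 3 | [:: ((((Z 1 \d Y 1) * Y 2) \d X 1) * X 2) * \S X 3] }>.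
  by_normalization.
through <{ 3 | [:: ((Z 1 \d X 3) \d (Y 1 \d X 2)) * (Y 2 \d X 1)] }>.
  by_step timesA.
by_step cycle1_of_a3.
Qed.

Lemma one_dot : [ [:: 1 \d X 1] =[1] [:: 1] ].
Proof.
apply: one_dot_of_idem.
through <{ 1 | [:: ((1 \d 1) * 1) \d X 1] }>; first by_normalization.
by_step dot_of_times.
Qed.

(** As (z.y2).S(y1) = z, the previous lemma applies to every product z S(y). *)
Lemma dot_mul_antipode : [ [:: (Z 1 * \S Y 1) \d X 1] =[3] [:: (Z 1 \d (X 1 \c \S Y 1)) * (\S Y 2 \d X 2)] ].
Proof.
through <{ 3 | [:: (((Z 1 \d Y 3) \d \S Y 2) * \S Y 1) \d X 1] }>.
  by_normalization.
through <{ 3 | [:: (Z 1 \d (X 2 \c \S Y 2)) * (\S Y 1 \d X 1)] }>.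
  by_step dot_of_times.
by_step exchange_rule.
Qed.

(** The exchange identity for lam_y(x) = x1.(y:S(x2)): the components of x on both
    sides of an occurrence of lam can be absorbed into it. *)
Lemma lam_exchange : [ [:: X 2 \d (Y 1 \c \S X 3); Y 2 \c (X 1 * \S X 4)] =[2]
             [:: X 1 \d (Y 2 \c \S X 2); Y 1] ].
Proof.
through <{ 2 | [:: X 2 \d (Y 1 \c \S X 3); (Y 2 \c \S X 4) \c X 1] }>.
  by_normalization.
by_step exchange_rule.
Qed.

(** The right-hand side is the comultiplication of lam_y(x) computed from the
    operations, the left-hand side has the form of a coalgebra map. *)
Lemma lam_comul : [ [:: X 1 \d (Y 1 \c \S X 2); X 3 \d (Y 2 \c \S X 4)] =[2]
               [:: X 1 \d (Y 2 \c \S X 4); X 2 \d (Y 1 \c \S X 3)] ].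
Proof. by_step lam_exchange. Qed.

(** [dot_mul_antipode] for z S(y) = x1 S(x2), which is a scalar. *)
Lemma lam_inverse : [ [:: (X 1 \d (Y 1 \c \S X 2)) * (\S X 3 \d Y 2)] =[2] [:: 1] ].
Proof.
through <{ 2 | [:: (X 1 * \S X 2) \d Y 1] }>; first by_step dot_mul_antipode.
through <{ 2 | [:: 1 \d Y 1] }>; first by_normalization.
by_step one_dot.
Qed.

(** Since lam is a coalgebra map, S(lam_y(x)) is its convolution inverse, and
    [lam_inverse] exhibits another right inverse. *)
Lemma antipode_lam : [ [:: \S (X 1 \d (Y 1 \c \S X 2))] =[2] [:: \S X 1 \d Y 1] ].
Proof.
through <{ 2 | [:: \S (X 1 \d (Y 1 \c \S X 2)) * ((X 3 \d (Y 2 \c \S X 4)) * (\S X 5 \d Y 3))] }>.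
  by apply: equiv_sym; by_step lam_inverse.
by_step lam_comul.
Qed.

(** Associativity of [boxtimes] for arbitrary z (x) y in place of z:y2 (x) y1, by
    (z:S(y3)):y2 (x) y1 = z (x) y.  The remaining factor x1 stands on the wrong side
    of x2 to be cancelled by S. *)
Lemma colon_of_boxtimes : [ [:: ((Z 1 * Y 1) \c X 2) * X 1] =[3]
   [:: (Z 1 \c (X 2 \d Y 2)) * ((Y 1 \c X 3) * X 1)] ].
Proof.
through <{ 3 | [:: ((((Z 1 \c \S Y 3) \c Y 2) * Y 1) \c X 2) * X 1] }>.
  by_normalization.
through <{ 3 | [:: (((Z 1 \c \S Y 3) \c X 2) \c (Y 2 \c X 3)) * ((Y 1 \c X 4) * X 1)] }>.
  by_step boxtimesA.
by_step cycle3_of_b3.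
Qed.

(** For x = S(w) the factor that could not be cancelled becomes S(w2), and it is
    cancelled by w3. *)
Lemma colon_antipode : [ [:: (Z 1 * Y 1) \c \S X 1] =[3]
   [:: (Z 1 \c (\S X 2 \d Y 2)) * (Y 1 \c \S X 1)] ].
Proof.
through <{ 3 | [:: (((Z 1 * Y 1) \c \S X 1) * \S X 2) * X 3] }>; first by_normalization.
by_step colon_of_boxtimes.
Qed.

Lemma one_colon_antipode : [ [:: 1 \c \S X 1] =[1] [:: 1] ].
Proof.
have u : [ [:: 1 \c \S X 1] =[1] [:: (1 \c \S X 1) * (1 \c \S X 2)] ].
  through <{ 1 | [:: (1 * 1) \c \S X 1] }>; first by_normalization.
  through <{ 1 | [:: (1 \c (\S X 2)) * (1 \c \S X 1)] }>; first by_step colon_antipode.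
  by_step one_colon_swap.
through <{ 1 | [:: \S (1 \c \S X 1) * ((1 \c \S X 2) * (1 \c \S X 3))] }>.
  by_normalization.
by_step u.
Qed.

(** If 1:S(x) is trivial, so is 1:x = (1:S(x2)):x1 = 1:(x1 S(x2)). *)
Lemma one_colon : [ [:: 1 \c X 1] =[1] [:: 1] ].
Proof.
through <{ 1 | [:: (1 \c \S X 2) \c X 1] }>.
  by apply: equiv_sym; by_step one_colon_antipode.
by_normalization.
Qed.

(** lam_(zy)(x) = lam_z(lam_y(x)), the right-hand side being expanded with the
    comultiplication of lam_y(x). *)
Lemma lam_action : [ [:: X 1 \d ((Z 1 * Y 1) \c \S X 2)] =[3]
   [:: (X 1 \d (Y 2 \c \S X 4)) \d (Z 1 \c \S (X 2 \d (Y 1 \c \S X 3)))] ].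
Proof.
through <{ 3 | [:: (X 1 \d (Y 1 \c \S X 2)) \d (Z 1 \c (\S X 3 \d Y 2))] }>.
  by_step colon_antipode.
through <{ 3 | [:: (X 1 \d (Y 1 \c \S X 2)) \d (Z 1 \c \S (X 3 \d (Y 2 \c \S X 4)))] }>.
  by_step antipode_lam.
by_step lam_comul.
Qed.

Lemma antipode_dot : [ [:: \S (X 1 \d Y 1)] =[2] [:: \S X 1 \d (Y 1 \c X 2)] ].
Proof. by apply: equiv_sym; by_step antipode_lam. Qed.

Lemma antipode2_lam : [ [:: \S \S (X 1 \d (Y 1 \c \S X 2))] =[2] [:: \S \S X 2 \d (Y 1 \c \S X 1)] ].
Proof.
through <{ 2 | [:: \S (\S X 1 \d Y 1)] }>; first by_step antipode_lam.
by_step antipode_dot.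
Qed.

(** [lam_comul] for three components: the last two are those of one output of
    [lam_comul]. *)
Lemma lam_comul3 : [ [:: X 1 \d (Y 1 \c \S X 2); X 3 \d (Y 2 \c \S X 4); X 5 \d (Y 3 \c \S X 6)] =[2]
  [:: X 1 \d (Y 3 \c \S X 6); X 2 \d (Y 2 \c \S X 5); X 3 \d (Y 1 \c \S X 4)] ].
Proof.
through <{ 2 | [:: X 1 \d (Y 1 \c \S X 2); X 3 \d (Y 3 \c \S X 6); X 4 \d (Y 2 \c \S X 5)] }>.
  by_step lam_comul.
have e := equiv_compr (D := <{ 2 | [:: X 1; Y 1; Y 2] }>) lam_comul isT isT.
by_computation_from e.
Qed.

(** rho_(zy)(x) = rho_z(rho_y(x)) for rho_y(x) = x2.((y:SS(x1)):S(x3)), which is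
    lam with y replaced by y:SS(x1).  Both sides become the same expression up to
    the order of the components of y and of SS(x), which the exchange identity
    adjusts. *)
Lemma rho_action : [ [:: X 2 \d (((Z 1 * Y 1) \c \S \S X 1) \c \S X 3)] =[3]
  [:: (X 5 \d ((Y 2 \c \S \S X 2) \c \S X 8)) \d
      ((Z 1 \c \S \S (X 4 \d ((Y 3 \c \S \S X 1) \c \S X 9))) \c
         \S (X 6 \d ((Y 1 \c \S \S X 3) \c \S X 7)))] ].
Proof.
through <{ 3 | [:: X 3 \d (((Z 1 \c (\S \S X 1 \d Y 2)) * (Y 1 \c \S \S X 2)) \c \S X 4)] }>.
  by_step colon_antipode.
through <{ 3 | [:: (X 4 \d ((Y 2 \c \S \S X 2) \c \S X 7)) \d
   ((Z 1 \c (\S \S X 1 \d Y 3)) \c \S (X 5 \d ((Y 1 \c \S \S X 3) \c \S X 6)))] }>.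
  by_step lam_action.
through <{ 3 | [:: (X 4 \d ((Y 1 \c \S \S X 3) \c \S X 5)) \d
   ((Z 1 \c (\S \S X 1 \d Y 3)) \c \S (X 6 \d ((Y 2 \c \S \S X 2) \c \S X 7)))] }>.
  by_step lam_comul.
(* the side of rho_z(rho_y(x)) *)
apply: equiv_sym.
through <{ 3 | [:: (X 6 \d ((Y 2 \c \S \S X 2) \c \S X 7)) \d
   ((Z 1 \c \S \S (X 4 \d ((Y 1 \c \S \S X 3) \c \S X 5))) \c
      \S (X 8 \d ((Y 3 \c \S \S X 1) \c \S X 9)))] }>.
  by_step lam_comul3.
through <{ 3 | [:: (X 4 \d ((Y 2 \c \S \S X 2) \c \S X 5)) \d
   ((Z 1 \c (\S \S X 3 \d Y 1)) \c \S (X 6 \d ((Y 3 \c \S \S X 1) \c \S X 7)))] }>.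
  by_step antipode2_lam.
through <{ 3 | [:: (X 4 \d ((Y 1 \c \S \S X 3) \c \S X 5)) \d
   ((Z 1 \c (\S \S X 2 \d Y 2)) \c \S (X 6 \d ((Y 3 \c \S \S X 1) \c \S X 7)))] }>.
  by_step exchange_rule.
by_step exchange_rule.
Qed.

(** The second output is y acted upon by the right adjoint coaction S(x1) x3. *)
Definition coadj_expr := <{ 2 | [:: X 2; Y 1 \c (\S X 1 * X 3)] }>.
Definition coadj_inv_expr := <{ 2 | [:: X 2; Y 1 \c \S (\S X 1 * X 3)] }>.
Definition rho_expr := <{ 2 | [:: X 2 \d ((Y 2 \c \S \S X 1) \c \S X 3); Y 1] }>.
Definition rho_inv_expr := <{ 2 | [:: X 2 \d ((\S Y 2 \c \S \S X 1) \c \S X 3); Y 1] }>.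
Definition left_regular_inv_expr := comp coadj_inv_expr rho_inv_expr.

Definition trivial_rules : seq (expr * expr) :=
  [:: rl 1 [:: 1 \d X 1] [:: 1]; rl 1 [:: 1 \c X 1] [:: 1]] ++ module_rules.
Lemma trivial_rules_sound : sound trivial_rules.
Proof.
by split; [exact: one_dot|split; [exact: one_colon|exact: module_rules_sound]].
Qed.

Lemma coadjK : equiv (comp coadj_inv_expr coadj_expr) id_expr.
Proof. by_normalization. Qed.
Lemma coadjVK : equiv (comp coadj_expr coadj_inv_expr) id_expr.
Proof. by_normalization. Qed.
Lemma rhoK : equiv (comp rho_inv_expr rho_expr) id_expr.
Proof. by_step_using trivial_rules_sound rho_action. Qed.
Lemma rhoVK : equiv (comp rho_expr rho_inv_expr) id_expr.
Proof. by_step_using trivial_rules_sound rho_action. Qed.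

(** Acting by S(x1) x3 undoes the conjugation that is built into rho, and leaves
    x2.y2 (x) (y1:x3):S(x1), where the exchange identity applies. *)
Lemma left_regular_factor : equiv (comp rho_expr coadj_expr) left_regular_expr.
Proof.
apply: equiv_sym.
through <{ 2 | [:: X 3 \d Y 1; (Y 2 \c X 2) \c \S X 1] }>; first by_normalization.
by_step exchange_rule.
Qed.

Lemma left_regularK : equiv (comp left_regular_inv_expr left_regular_expr) id_expr.
Proof.
through (comp left_regular_inv_expr (comp rho_expr coadj_expr)).
  by apply/equiv_sym/equiv_compr => //; exact: left_regular_factor.
through (comp coadj_inv_expr (comp id_expr coadj_expr)); last first.
  by_computation_from coadjK.
have e : equiv (comp (comp rho_inv_expr rho_expr) coadj_expr) (comp id_expr coadj_expr).
  by apply: equiv_compl => //; exact: rhoK.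
by_computation_from (equiv_compr (D := coadj_inv_expr) e isT isT).
Qed.

Lemma left_regularVK : equiv (comp left_regular_expr left_regular_inv_expr) id_expr.
Proof.
through (comp (comp rho_expr coadj_expr) left_regular_inv_expr).
  by apply/equiv_sym/equiv_compl => //; exact: left_regular_factor.
through (comp rho_expr rho_inv_expr); last exact: rhoVK.
have e : equiv (comp (comp coadj_expr coadj_inv_expr) rho_inv_expr) (comp id_expr rho_inv_expr).
  by apply: equiv_compl => //; exact: coadjVK.
by_computation_from (equiv_compr (D := rho_expr) e isT isT).
Qed.

Lemma left_regular_of_assoc : left_regular HH dot.
Proof.
have mapE t : left_regular_map HH dot t = expr_map left_regular_expr t.
  by rewrite /left_regular_expr; norm_expr; apply: eq_sw => x y; rewrite /value2.
exists (expr_map left_regular_inv_expr) => t; rewrite mapE expr_map_comp //.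
- by rewrite (equiv_expr_map left_regularK) // expr_map_id.
- by rewrite (equiv_expr_map left_regularVK) // expr_map_id.
Qed.

(** Every h (x) m is a sum of elements x.y1 (x) y2, for which the law is
    [dot_of_times]. *)
Lemma brace_dot_of_assoc : brace_dot.
Proof.
pose D := <{ 3 | [:: (X 1 * Y 1) \d Z 1] }>.
pose R := <{ 3 | [:: (X 1 \d (Z 1 \c Y 2)) * (Y 1 \d Z 2)] }>.
pose L := left_regular_expr.
have DR : equiv (comp D (extend 1 L)) (comp R (extend 1 L)).
  through <{ 3 | [:: ((X 1 \d Y 1) \d (Z 2 \c Y 2)) * (Y 3 \d Z 1)] }>.
    by_step dot_of_times.
  by_step exchange_rule.
pose K := comp L left_regular_inv_expr.
have split_id E : comp_ok E (extend 1 K) -> comp_ok E (extend 1 id_expr) ->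
    equiv (comp E (extend 1 K)) (comp E (extend 1 id_expr)).
  by move=> ? ?; apply: equiv_compr => //; apply: equiv_extend => //; exact: left_regularVK.
suff e : equiv D R by by_step e.
through (comp D (extend 1 K)).
  by_computation_from (equiv_sym (split_id D isT isT)).
through (comp R (extend 1 K)); last by by_computation_from (split_id R isT isT).
by_computation_from (equiv_compl (A := extend 1 left_regular_inv_expr) DR isT isT).
Qed.

(** Write R_l(h (x) m) = h:(l1.m2) (x) m1:l2.  By [brace_dot_of_assoc], R is an action
    of l, and [colon_antipode] says that (uv):S(l) is the product of R_(S(l)) (u (x) v).
    Hence the product of R_l(h (x) m) is
    ((product of R_(l3) (h (x) m)) : S(l2)) : l1 = (product of
    R_(S(l2)) R_(l3) (h (x) m)) : l1 = hm:l. *)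
Lemma brace_colon_of_assoc : brace_colon.
Proof.
apply: equiv_sym.
through <{ 3 | [:: (((X 1 \c (Y 3 \d Z 2)) * (Z 1 \c Y 4)) \c \S Y 2) \c Y 1] }>.
  by_normalization.
through <{ 3 | [:: ((X 1 \c ((\S Y 3 \d (Z 2 \c Y 5)) * (Y 4 \d Z 3))) *
                    ((Z 1 \c Y 6) \c \S Y 2)) \c Y 1] }>; first by_step colon_antipode.
by_step_using trivial_rules_sound brace_dot_of_assoc.
Qed.

(** [eq_b2] and [brace_colon_of_assoc] expand the same term; their common factor y:z is
    cancelled by its antipode. *)
Lemma cycle2_of_assoc : cycle2.
Proof.
through <{ 3 | [:: (((X 1 \d Y 1) \c (Z 3 \d Y 2)) * (Y 3 \c Z 2)) * \S (Y 4 \c Z 1)] }>.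
  by_normalization.
through <{ 3 | [:: (((X 1 \d Y 1) \c (Z 2 \d Y 3)) * (Y 2 \c Z 3)) * \S (Y 4 \c Z 1)] }>.
  by_step exchange_rule.
through <{ 3 | [:: (((X 1 \d Y 1) * Y 2) \c Z 2) * \S (Y 3 \c Z 1)] }>.
  by_step brace_colon_of_assoc.
by_step hb2.
Qed.

End ToBrace.

End Modules.
End SweedlerCalculus.

Theorem proposition5p36 (k : fieldType) (H : algType k) (HH : hopf_algebra H)
    (dot colon : {linear (H \ot H)%type -> H})
    (qmagma : q_magma_coalgebra HH dot colon) :
  (hopf_q_brace HH dot colon ->
     [/\ associative (times HH dot),
         left_id 1 (times HH dot) & right_id 1 (times HH dot)] /\
     [/\ associative (boxtimes HH colon),
         left_id 1 (boxtimes HH colon) & right_id 1 (boxtimes HH colon)] /\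
     [/\ eq_a1 dot, eq_a2 HH dot colon & eq_a3 HH dot colon] /\
     [/\ eq_b1 colon, eq_b2 HH dot colon & eq_b3 HH dot colon]) /\
  (associative (times HH dot) -> left_id 1 (times HH dot) ->
   associative (boxtimes HH colon) -> left_id 1 (boxtimes HH colon) ->
   eq_a1 dot -> eq_a3 HH dot colon ->
   eq_b1 colon -> eq_b2 HH dot colon -> eq_b3 HH dot colon ->
   hopf_q_brace HH dot colon).
Proof.
split=> [[[_ _ c1 c2 c3] mdot mcolon bd bc]|tA t1 bA b1 ha1 ha3 hb1 hb2 hb3].
  have {}bd := (brace_dotP HH dot colon).2 bd.
  have {}bc := (brace_colonP HH dot colon).2 bc.
  have {}c1 := (cycle1P HH dot colon).2 c1.
  have {}c2 := (cycle2P HH dot colon).2 c2.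
  have {}c3 := (cycle3P HH dot colon).2 c3.
  split; [|split; [|split]].
  - split; first exact/(times_assocP qmagma)/times_assoc_of_brace.
    + by move=> l; rewrite times1E; case: mdot.
    + apply: (times_right1 qmagma mdot mcolon); exact: one_dot_of_brace.
  - split; first exact/(boxtimes_assocP qmagma)/boxtimes_assoc_of_brace.
    + by move=> l; rewrite boxtimes1E; case: mcolon.
    + apply: (boxtimes_right1 qmagma mdot mcolon); exact: one_colon_of_brace.
  - split; first by case: mdot.
    + exact/(rule_a2P qmagma)/a2_of_brace.
    + exact/rule_a3P/a3_of_brace.
  - split; first by case: mcolon.
    + exact/(rule_b2P qmagma)/b2_of_brace.
    + exact/rule_b3P/b3_of_brace.
have mdot : right_op_module dot by split=> // h; rewrite -[RHS]t1 times1E.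
have mcolon : right_op_module colon by split=> // h; rewrite -[RHS]b1 boxtimes1E.
have {}tA := (times_assocP qmagma).2 tA.
have {}bA := (boxtimes_assocP qmagma).2 bA.
have {}ha3 := (rule_a3P HH dot colon).2 ha3.
have {}hb3 := (rule_b3P HH dot colon).2 hb3.
have {}hb2 := (rule_b2P qmagma).2 hb2.
have bd := brace_dot_of_assoc qmagma mdot mcolon tA bA ha3 hb3.
have bc := brace_colon_of_assoc qmagma mdot mcolon tA bA ha3 hb3.
have c2 := cycle2_of_assoc qmagma mdot mcolon tA bA ha3 hb3 hb2.
split=> //.
- split=> //.
  + exact: (left_regular_of_assoc qmagma mdot mcolon tA bA ha3 hb3).
  + exact/cycle1P/cycle1_of_a3.
  + exact/cycle2P.
  + exact/cycle3P/cycle3_of_b3.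
- exact/brace_dotP.
- exact/brace_colonP.
Qed.
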